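(* Let $V_0\subseteq V_1$ be models of set theory, let $(\mathcal{M}_0,f_0,\mathcal{W}_0)\in V_0$ be a generalized dynamical system (in the sense of $V_0$), and let $(\mathcal{M}_1,f_1,\mathcal{W}_1)\in V_1$ be its relativization to $V_1$ for being a generalized dynamical system. Suppose that (in $V_0$) $\mathcal{W}_0$ is a continuous distance monoid with $\mathrm{coinit}(\mathcal{W}_0)=\omega$. Then $(\mathcal{M}_0,f_0)$ has a fixed point if and only if $(\mathcal{M}_1,f_1)$ has a fixed point.
   Context: **Models of set theory.** We work in a background model of ZFC; a *model of set theory* is a transitive subclass $V$ of it with $(V,\in)\models \mathrm{ZFC}$. **Distance monoids.** A *distance monoid* (commutative positive linear ordered monoid) is $\mathcal{W}=\langle W,+,0,\leq\rangle$ where $\langle W,+,0\rangle$ is a commutative monoid, $\leq$ is a linear order with minimal element $0$, $a\leq b$ implies $c+a\leq c+b$ and $a+c\leq b+c$, and $b+\bigwedge A=\bigwedge_{a\in A}(a+b)$ for all $b\in W$ and $A\subseteq W$ (whose infimum exists). Write $W^+=W\setminus\{0\}$. $\mathcal{W}$ is *continuous at $0$* if $0=\bigwedge_{a,b\in W^+}(a+b)$; *complete* if $\langle W,\leq\rangle$ is a complete linear order; *continuous* if complete and continuous at $0$. The *completion* $\overline{\mathcal{W}}$ of $\mathcal{W}$ is the distance monoid whose order is the Dedekind–MacNeille completion of $\langle W,\leq\rangle$ and whose addition extends that of $\mathcal W$; explicitly $a+b=\bigwedge\{a'+b' : a',b'\in W,\ a'\geq a,\ b'\geq b\}$. **Coinitiality.**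 An *initial sequence* in $\mathcal{W}$ is an order preserving map $s:(\alpha^{op},\leq)\to(W^+,\leq)$, $\alpha$ an ordinal (so $i\leq j$ implies $s(j)\leq s(i)$), such that for every $a\in W^+$ there is $\beta\in\alpha$ with $s(\beta)\leq a$. $\mathrm{coinit}(\mathcal{W})$ is the smallest ordinal that is the domain of an initial sequence. **$\mathcal{W}$-metric spaces.** A *$\mathcal{W}$-metric space* is $\mathcal{M}=(M,d)$ with $d:M\times M\to W$ (not assumed symmetric) such that $\max(d(x,y),d(y,x))=0$ iff $x=y$, and $d(x,z)\leq d(x,y)+d(y,z)$. A map $f$ is *non-expanding* if $d(f(x),f(y))\leq d(x,y)$ for all $x,y$. **Cauchy completeness.** A *Cauchy sequence* on $\mathcal{M}$ is a map $p:A\to M$, $A\subseteq W^+$ with $\bigwedge_{a,b\in A}(a+b)=0$, such that $d(p(a),p(b))\leq a+b$ for all $a,b\in A$; $\mathrm{dom}(p)=A$. It *converges* to $x\in M$ if $\bigvee_{a\in W^+}\bigwedge_{b\leq a,\,b\in \mathrm{dom}(p)}d(x,p(b))=0$ and $\bigvee_{a\in W^+}\bigwedge_{b\leq a,\,b\in \mathrm{dom}(p)}d(p(b),x)=0$. $(\mathcal{M},\mathcal{W})$ is *Cauchy complete* if $\mathcal{W}$ is complete and every Cauchy sequence on $\mathcal M$ converges to an element of $M$. (If $\mathcal{W}$ is not continuous at $0$ there are no Cauchy sequences.) **Cauchy completion.** If $\mathcal{W}$ is continuous, for Cauchy sequences $p,q$ put $d(p,q)=\bigvee_{c\in W^+}\bigwedge\{d(p(a),q(b))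 : a\in \mathrm{dom}(p), b\in\mathrm{dom}(q), a,b\leq c\}$, and $p\equiv q$ iff $d(p,q)=d(q,p)=0$. The Cauchy completion $\mathbf{cc}(\mathcal{M})$ is the space of $\equiv$-classes with the induced distance, where each $x\in M$ is identified with the class of the constant sequence $\widehat{x}:W^+\to M$ with value $x$, so that $M\subseteq \mathbf{cc}(M)$. If $\mathcal{W}$ is not continuous at $0$, $\mathbf{cc}(\mathcal{M})$ is $\mathcal{M}$ regarded as a $\overline{\mathcal{W}}$-metric space. In general the Cauchy completion of $(\mathcal{M},\mathcal{W})$ is $(\mathbf{cc}(\mathcal{M}),\overline{\mathcal{W}})$, where for $\mathcal{W}$ continuous at $0$ one first regards $\mathcal M$ as a $\overline{\mathcal{W}}$-metric space. A non-expanding $f:\mathcal{M}\to\mathcal{M}$ has a unique non-expanding extension $\mathbf{cc}(f):\mathbf{cc}(\mathcal{M})\to\mathbf{cc}(\mathcal{M})$. **Dynamical systems.** For $\mathcal{W}$ a complete distance monoid, a *$\mathcal{W}$-dynamical system* is $(\mathcal{M},f)$ with $\mathcal{M}$ a Cauchy complete $\mathcal{W}$-metric space and $f:\mathcal{M}\to\mathcal{M}$ non-expanding; then $(\mathcal{M},f,\mathcal{W})$ is a *generalized dynamical system*. It *has a fixed point* if $f(x)=x$ for some $x\in M$. **Relativization.** For models of set theory $V_0\subseteq V_1$ and a generalized dynamical system $(\mathcal{M},f,\mathcal{W})\in V_0$ (in the sense of $V_0$), its *relativization to $V_1$ for being a generalized dynamical system* is $(\mathbf{cc}(\mathcal{M}),\mathbf{cc}(f),\overline{\mathcal{W}})^{V_1}$,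 i.e. these completions computed in $V_1$. *)

(* Defs.v *)
From Stdlib Require Import ClassicalEpsilon.

Set Implicit Arguments.
Unset Strict Implicit.

(** * Models of ZFC *)

(* First-order formulas in the language of set theory, with de Bruijn
   variables; [fall] binds variable 0.  The other connectives are classically
   definable from these. *)
Inductive formula : Type :=
| fmem (i j : nat)
| feq (i j : nat)
| fneg (p : formula)
| fand (p q : formula)
| fall (p : formula).

Definition scons (X : Type) (x : X) (e : nat -> X) (n : nat) : X :=
  match n with O => x | S k => e k end.

Fixpoint sat (X : Type) (E : X -> X -> Prop) (e : nat -> X) (p : formula)
    : Prop :=
  match p with
  | fmem i j => E (e i) (e j)
  | feq i j => e i = e j
  | fneg p => ~ sat E e p
  | fand p q => sat E e p /\ sat E e q
  | fall p => forall x : X, sat E (scons x e) p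
  end.

(* [ZFC E] says that the structure (X, E) satisfies ZFC.  In the two schemata
   the environment [e] supplies the parameters. *)
Record ZFC (X : Type) (E : X -> X -> Prop) : Prop := {
  zf_extensionality : forall a b, (forall x, E x a <-> E x b) -> a = b;
  zf_foundation : forall a, (exists x, E x a) ->
    exists x, E x a /\ ~ exists y, E y x /\ E y a;
  zf_pairing : forall a b, exists c, forall x, E x c <-> x = a \/ x = b;
  zf_union : forall a, exists c, forall x, E x c <-> exists y, E y a /\ E x y;
  zf_power_set : forall a, exists c,
    forall x, E x c <-> forall y, E y x -> E y a;
  zf_infinity : exists a,
    (exists z, (forall y, ~ E y z) /\ E z a) /\
    (forall x, E x a ->
       exists s, (forall y, E y s <-> E y x \/ y = x) /\ E s a);
  zf_separation : forall (p : formula) (e : nat -> X) a,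
    exists b, forall x, E x b <-> E x a /\ sat E (scons x e) p;
  zf_replacement : forall (p : formula) (e : nat -> X) a,
    (forall x, E x a -> exists! y, sat E (scons y (scons x e)) p) ->
    exists b, forall y,
      E y b <-> exists x, E x a /\ sat E (scons y (scons x e)) p;
  zf_choice : forall a,
    (forall x, E x a -> exists z, E z x) ->
    (forall x y z, E x a -> E y a -> E z x -> E z y -> x = y) ->
    exists c, forall x, E x a -> exists! z, E z x /\ E z c
}.

Record zfc_model : Type := {
  mdl_sort :> Type;
  mem : mdl_sort -> mdl_sort -> Prop;
  zfc_axioms : ZFC mem
}.

Notation "x ∈ a" := (mem x a) (at level 70, no associativity).

(* A model of set theory inside the background model [B]: a transitive
   subclass V of B (possibly a set of B) with (V, ∈) a model of ZFC. *)
Record transitive_model (B : zfc_model) : Type := {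
  class_of :> B -> Prop;
  class_trans : forall x y : B, class_of x -> y ∈ x -> class_of y;
  class_zfc : ZFC (fun x y : {z : B | class_of z} => proj1_sig x ∈ proj1_sig y)
}.

Definition inner (B : zfc_model) (V : transitive_model B) : zfc_model :=
  {| mdl_sort := {z : B | V z};
     mem := fun x y => proj1_sig x ∈ proj1_sig y;
     zfc_axioms := class_zfc V |}.

Definition incl (B : zfc_model) (V0 V1 : transitive_model B)
    (h : forall x : B, V0 x -> V1 x) (x : inner V0) : inner V1 :=
  exist (fun z : B => V1 z) (proj1_sig x) (h _ (proj2_sig x)).

(** * Basic set theory inside a model

    Everything from here on is evaluated inside a given model S: all
    quantifiers range over S, so that a notion at [S := inner V] is its
    relativization to V. *)

Lemma zfc_inhabited (S : zfc_model) : inhabited S.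
Proof. destruct (zf_infinity (zfc_axioms S)) as [a _]. exact (inhabits a). Qed.

(* The element with property P, used only where it exists and is unique. *)
Definition the (S : zfc_model) (P : S -> Prop) : S := epsilon (zfc_inhabited S) P.

(* The set {x | P x}; meaningful when this class is a set of S. *)
Definition setof (S : zfc_model) (P : S -> Prop) : S :=
  the (fun a => forall x, x ∈ a <-> P x).

Definition subset (S : zfc_model) (a b : S) : Prop := forall x, x ∈ a -> x ∈ b.

Notation "a ⊆ b" := (subset a b) (at level 70, no associativity).

Definition upair (S : zfc_model) (a b : S) : S := setof (fun x => x = a \/ x = b).

Definition opair (S : zfc_model) (a b : S) : S := upair (upair a a) (upair a b).

Definition cart (S : zfc_model) (A B : S) : S :=
  setof (fun z => exists x y, x ∈ A /\ y ∈ B /\ z = opair x y).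

(* Functions are sets of ordered pairs. *)
Definition is_fun (S : zfc_model) (f A B : S) : Prop :=
  f ⊆ cart A B /\ forall x, x ∈ A -> exists! y, opair x y ∈ f.

Definition ap (S : zfc_model) (f x : S) : S := the (fun y => opair x y ∈ f).

Definition ap2 (S : zfc_model) (f x y : S) : S := ap f (opair x y).

Definition indom (S : zfc_model) (f x : S) : Prop := exists y, opair x y ∈ f.

(* Ordinals as transitive sets of transitive sets (using foundation). *)
Definition trans_set (S : zfc_model) (a : S) : Prop := forall x, x ∈ a -> x ⊆ a.

Definition ordinal (S : zfc_model) (a : S) : Prop :=
  trans_set a /\ forall x, x ∈ a -> trans_set x.

Definition ord_le (S : zfc_model) (a b : S) : Prop := a ∈ b \/ a = b.

Definition inductive_set (S : zfc_model) (a : S) : Prop :=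
  (forall z, (forall y, ~ y ∈ z) -> z ∈ a) /\
  (forall x s, x ∈ a -> (forall y, y ∈ s <-> y ∈ x \/ y = x) -> s ∈ a).

Definition is_omega (S : zfc_model) (o : S) : Prop :=
  inductive_set o /\ forall a, inductive_set a -> o ⊆ a.

(** * Distance monoids *)

Record monoid (S : zfc_model) : Type := {
  car :> S;
  add : S;
  zero : S;
  ordrel : S
}.

Definition plus (S : zfc_model) (W : monoid S) (a b : S) : S := ap2 (add W) a b.

Definition leq (S : zfc_model) (W : monoid S) (a b : S) : Prop :=
  opair a b ∈ ordrel W.

(* W^+ *)
Definition positive (S : zfc_model) (W : monoid S) (a : S) : Prop :=
  a ∈ W /\ a <> zero W.

(* In [is_inf] and [is_sup], P describes a subclass of W. *)
Definition is_inf (S : zfc_model) (W : monoid S) (P : S -> Prop) (m : S) : Prop :=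
  m ∈ W /\ (forall x, P x -> leq W m x) /\
  forall l, l ∈ W -> (forall x, P x -> leq W l x) -> leq W l m.

Definition is_sup (S : zfc_model) (W : monoid S) (P : S -> Prop) (m : S) : Prop :=
  m ∈ W /\ (forall x, P x -> leq W x m) /\
  forall l, l ∈ W -> (forall x, P x -> leq W x l) -> leq W m l.

Definition is_max (S : zfc_model) (W : monoid S) (a b m : S) : Prop :=
  (leq W a b /\ m = b) \/ (leq W b a /\ m = a).

Record distance_monoid (S : zfc_model) (W : monoid S) : Prop := {
  dm_zero : zero W ∈ W;
  dm_add : is_fun (add W) (cart W W) W;
  dm_ord : ordrel W ⊆ cart W W;
  dm_assoc : forall a b c, a ∈ W -> b ∈ W -> c ∈ W ->
    plus W a (plus W b c) = plus W (plus W a b) c;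
  dm_comm : forall a b, a ∈ W -> b ∈ W -> plus W a b = plus W b a;
  dm_unit : forall a, a ∈ W -> plus W (zero W) a = a;
  dm_refl : forall a, a ∈ W -> leq W a a;
  dm_antisym : forall a b, a ∈ W -> b ∈ W -> leq W a b -> leq W b a -> a = b;
  dm_trans : forall a b c, a ∈ W -> b ∈ W -> c ∈ W ->
    leq W a b -> leq W b c -> leq W a c;
  dm_total : forall a b, a ∈ W -> b ∈ W -> leq W a b \/ leq W b a;
  dm_min : forall a, a ∈ W -> leq W (zero W) a;
  dm_mono : forall a b c, a ∈ W -> b ∈ W -> c ∈ W -> leq W a b ->
    leq W (plus W c a) (plus W c b) /\ leq W (plus W a c) (plus W b c);
  dm_inf : forall A b m, A ⊆ W -> b ∈ W -> is_inf W (fun a => a ∈ A) m ->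
    is_inf W (fun u => exists a, a ∈ A /\ u = plus W a b) (plus W b m)
}.

Definition continuous_at0 (S : zfc_model) (W : monoid S) : Prop :=
  is_inf W (fun u => exists a b, positive W a /\ positive W b /\ u = plus W a b) (zero W).

Definition complete (S : zfc_model) (W : monoid S) : Prop :=
  forall A, A ⊆ W ->
    (exists m, is_inf W (fun a => a ∈ A) m) /\
    (exists m, is_sup W (fun a => a ∈ A) m).

Definition continuous (S : zfc_model) (W : monoid S) : Prop :=
  complete W /\ continuous_at0 W.

Definition initial_sequence (S : zfc_model) (W : monoid S) (α s : S) : Prop :=
  ordinal α /\ is_fun s α W /\
  (forall i, i ∈ α -> positive W (ap s i)) /\
  (forall i j, i ∈ α -> j ∈ α -> ord_le i j -> leq W (ap s j) (ap s i)) /\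
  (forall a, positive W a -> exists β, β ∈ α /\ leq W (ap s β) a).

Definition is_coinit (S : zfc_model) (W : monoid S) (α : S) : Prop :=
  (exists s, initial_sequence W α s) /\
  forall β s, initial_sequence W β s -> ord_le α β.

(* The embedding of W in its Dedekind-MacNeille completion: w is sent to the
   cut {v ∈ W | v ≤ w}. *)
Definition cut (S : zfc_model) (W : monoid S) (w : S) : S :=
  setof (fun v => v ∈ W /\ leq W v w).

(* The elements of the completion are the subsets of W that contain every
   lower bound of their set of upper bounds, ordered by inclusion. *)
Record is_completion (S : zfc_model) (W Wb : monoid S) : Prop := {
  compl_car : forall c, c ∈ Wb <->
    c ⊆ W /\
    forall w, w ∈ W ->
      (forall u, u ∈ W -> (forall v, v ∈ c -> leq W v u) -> leq W w u) -> w ∈ c;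
  compl_zero : zero Wb = cut W (zero W);
  compl_ord_sub : ordrel Wb ⊆ cart Wb Wb;
  compl_ord : forall c c', c ∈ Wb -> c' ∈ Wb -> (leq Wb c c' <-> c ⊆ c');
  compl_add_fun : is_fun (add Wb) (cart Wb Wb) Wb;
  compl_add : forall a b, a ∈ Wb -> b ∈ Wb ->
    is_inf Wb
      (fun u => exists a' b', a' ∈ W /\ b' ∈ W /\
         leq Wb a (cut W a') /\ leq Wb b (cut W b') /\
         u = cut W (plus W a' b'))
      (plus Wb a b)
}.

(** * Metric spaces over a distance monoid *)

Record mspace (S : zfc_model) : Type := {
  pts :> S;
  dfun : S
}.

Definition dist (S : zfc_model) (M : mspace S) (x y : S) : S := ap2 (dfun M) x y.

Record metric_space (S : zfc_model) (W : monoid S) (M : mspace S) : Prop := {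
  ms_fun : is_fun (dfun M) (cart M M) W;
  ms_sep : forall x y, x ∈ M -> y ∈ M ->
    (is_max W (dist M x y) (dist M y x) (zero W) <-> x = y);
  ms_tri : forall x y z, x ∈ M -> y ∈ M -> z ∈ M ->
    leq W (dist M x z) (plus W (dist M x y) (dist M y z))
}.

Definition non_expanding (S : zfc_model) (W : monoid S) (M : mspace S) (f : S)
    : Prop :=
  is_fun f M M /\
  forall x y, x ∈ M -> y ∈ M -> leq W (dist M (ap f x) (ap f y)) (dist M x y).

Definition cauchy_seq (S : zfc_model) (W : monoid S) (M : mspace S) (p : S)
    : Prop :=
  exists A,
    (forall a, a ∈ A -> positive W a) /\
    is_inf W (fun u => exists a b, a ∈ A /\ b ∈ A /\ u = plus W a b) (zero W) /\
    is_fun p A M /\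
    forall a b, a ∈ A -> b ∈ A -> leq W (dist M (ap p a) (ap p b)) (plus W a b).

Definition converges (S : zfc_model) (W : monoid S) (M : mspace S) (p x : S)
    : Prop :=
  is_sup W
    (fun v => exists a, positive W a /\
       is_inf W (fun u => exists b, indom p b /\ leq W b a /\
                            u = dist M x (ap p b)) v)
    (zero W) /\
  is_sup W
    (fun v => exists a, positive W a /\
       is_inf W (fun u => exists b, indom p b /\ leq W b a /\
                            u = dist M (ap p b) x) v)
    (zero W).

Definition cauchy_complete (S : zfc_model) (W : monoid S) (M : mspace S) : Prop :=
  complete W /\
  forall p, cauchy_seq W M p -> exists x, x ∈ M /\ converges W M p x.

(** * Cauchy completion *)

(* [seq_dist W M p q r]: the distance d(p, q) of two Cauchy sequences is r. *)
Definition seq_dist (S : zfc_model) (W : monoid S) (M : mspace S) (p q r : S)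
    : Prop :=
  is_sup W
    (fun v => exists c, positive W c /\
       is_inf W (fun u => exists a b, indom p a /\ indom q b /\
                            leq W a c /\ leq W b c /\
                            u = dist M (ap p a) (ap q b)) v)
    r.

Definition seq_equiv (S : zfc_model) (W : monoid S) (M : mspace S) (p q : S)
    : Prop :=
  seq_dist W M p q (zero W) /\ seq_dist W M q p (zero W).

(* c is the equivalence class of p. *)
Definition is_class (S : zfc_model) (W : monoid S) (M : mspace S) (p c : S)
    : Prop :=
  forall q, q ∈ c <-> cauchy_seq W M q /\ seq_equiv W M p q.

(* Mc is the space of equivalence classes of Cauchy sequences on M, with the
   induced distance. *)
Record is_cauchy_quotient (S : zfc_model) (W : monoid S) (M Mc : mspace S)
    : Prop := {
  cq_class : forall c, c ∈ Mc -> exists p, cauchy_seq W M p /\ is_class W M p c;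
  cq_all : forall p, cauchy_seq W M p -> exists c, c ∈ Mc /\ is_class W M p c;
  cq_fun : is_fun (dfun Mc) (cart Mc Mc) W;
  cq_dist : forall c c' p q, c ∈ Mc -> c' ∈ Mc -> p ∈ c -> q ∈ c' ->
    seq_dist W M p q (dist Mc c c')
}.

(* The constant sequence on W^+ with value x. *)
Definition const_seq (S : zfc_model) (W : monoid S) (x : S) : S :=
  setof (fun z => exists a, positive W a /\ z = opair a x).

(* M' is the W-metric space M regarded as a Wb-metric space, for Wb the
   completion of W. *)
Definition regarded (S : zfc_model) (W Wb : monoid S) (M M' : mspace S) : Prop :=
  pts M' = pts M /\ is_fun (dfun M') (cart M M) Wb /\
  forall x y, x ∈ M -> y ∈ M -> dist M' x y = cut W (dist M x y).

(** * Generalized dynamical systems *)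

Record system (S : zfc_model) : Type := {
  space : mspace S;
  self_map : S;
  scale : monoid S
}.

Definition generalized_dynamical_system (S : zfc_model) (G : system S) : Prop :=
  distance_monoid (scale G) /\
  metric_space (scale G) (space G) /\
  cauchy_complete (scale G) (space G) /\
  non_expanding (scale G) (space G) (self_map G).

Definition has_fixed_point (S : zfc_model) (G : system S) : Prop :=
  exists x, x ∈ space G /\ ap (self_map G) x = x.

(* [system_completion G Gc]: Gc = (cc(M), cc(f), Wb) for G = (M, f, W), where
   Wb is the completion of W and M' is M regarded as a Wb-metric space.
   For W continuous at 0, cc(f) is the non-expanding extension of f along the
   identification of x with the class of the constant sequence x. *)
Definition system_completion (S : zfc_model) (G Gc : system S) : Prop :=
  let W := scale G in let M := space G in let f := self_map G in
  let Wb := scale Gc in let Mc := space Gc in let fc := self_map Gc in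
  is_completion W Wb /\
  exists M', regarded W Wb M M' /\
    (continuous_at0 W ->
       is_cauchy_quotient Wb M' Mc /\
       non_expanding Wb Mc fc /\
       forall x c, x ∈ M -> c ∈ Mc -> is_class Wb M' (const_seq Wb x) c ->
         is_class Wb M' (const_seq Wb (ap f x)) (ap fc c)) /\
    (~ continuous_at0 W -> Mc = M' /\ fc = f).

(** * Relativization *)

Section Transfer.
Context (B : zfc_model) (V0 V1 : transitive_model B).
Context (h : forall x : B, V0 x -> V1 x).

Definition incl_monoid (W : monoid (inner V0)) : monoid (inner V1) :=
  {| car := incl h W; add := incl h (add W);
     zero := incl h (zero W); ordrel := incl h (ordrel W) |}.

Definition incl_mspace (M : mspace (inner V0)) : mspace (inner V1) :=
  {| pts := incl h M; dfun := incl h (dfun M) |}.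

Definition incl_system (G : system (inner V0)) : system (inner V1) :=
  {| space := incl_mspace (space G); self_map := incl h (self_map G);
     scale := incl_monoid (scale G) |}.

(* G1 is the relativization of G0 to V1: the completions are computed in V1. *)
Definition relativization (G0 : system (inner V0)) (G1 : system (inner V1)) : Prop :=
  system_completion (incl_system G0) G1.

End Transfer.

(* Main.v *)
From Stdlib Require Import Classical ClassicalEpsilon FunctionalExtensionality Arith.
Require Import Defs.

Set Implicit Arguments.
Unset Strict Implicit.

(** A fixed point x of f0 gives one in V1, the class of the constant sequence at
    x. The converse is an instance of the absoluteness of well-foundedness.

    In V0, fix a decreasing sequence s of length omega that is coinitial in the
    positive elements of W, and consider balls with centre x in M and positive
    radius a such that x is moved by f by at most a, in both directions. From a
    ball (x, a) one may step to a ball (y, b) with b < a, with d(x, y) + b <= a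
    and d(y, x) + b <= a, and with b at most the next term of s
    ([step]). An infinite descending sequence of balls that lies in V0 is a
    Cauchy sequence in V0, and its limit is a fixed point of f because its terms
    are moved less and less ([fixed_point_of_descent]). Here the coinitiality
    omega enters, as the radii have to become arbitrarily small in omega
    many steps.

    It remains to find such a sequence in V0. Let c be a fixed point of the
    completion formed in V1, represented by a Cauchy sequence p in V1. Points of
    M close to c are moved only a little by f ([near_almost_fixed]); therefore
    each ball that contains c with some room to spare has, in V1, a smaller ball
    of the same kind as successor ([capturing_step]). So V1 sees that the
    relation is ill-founded at a ball around c with index 0, the root.

    On the well-founded part of the relation, V0 has a function g with g(u) in
    g(t) whenever u is a successor of t, the Mostowski collapse
    ([collapse_well_founded_part]). In V1 the values of g at the balls around c
    would contradict foundation, so the root is not in the well-founded part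
    ([capturing_unranked]). The nodes outside the well-founded part all have
    successors outside it, and dependent choice in V0 yields the required
    descending sequence ([dependent_choice]).

    Separation and replacement are schemata over formulas, so each use of them
    needs a proof that the predicate is first-order definable; the calculus of
    [definable] predicates provides these proofs. *)

(** * First-order definability *)

Fixpoint rename (f : nat -> nat) (p : formula) : formula :=
  match p with
  | fmem i j => fmem (f i) (f j)
  | feq i j => feq (f i) (f j)
  | fneg p => fneg (rename f p)
  | fand p q => fand (rename f p) (rename f q)
  | fall p => fall (rename (fun n => match n with O => O | S k => S (f k) end) p)
  end.

Lemma sat_rename (X : Type) (E : X -> X -> Prop) p : forall f e,
  sat E e (rename f p) <-> sat E (fun n => e (f n)) p.
Proof.
  induction p as [i j|i j|p IH|p IHp q IHq|p IH]; intros f e; simpl; try tauto.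
  - rewrite IH; tauto.
  - rewrite IHp, IHq; tauto.
  - assert (H : forall x, sat E (scons x e)
        (rename (fun n => match n with O => O | S k => S (f k) end) p)
        <-> sat E (scons x (fun n => e (f n))) p).
    { intro x. rewrite IH.
      replace (fun n => scons x e match n with O => O | S k => S (f k) end)
        with (scons x (fun n => e (f n))); [tauto|].
      apply functional_extensionality. now intros [|n]. }
    split; intros K x; apply H, K.
Qed.

Section Definability.
Context (S : zfc_model).
Implicit Types (P Q : (nat -> S) -> Prop) (t u : (nat -> S) -> S).

(** Each variable of a formula reads either a slot of the environment or a fixed
    element, so that parameters need not be collected in advance: formulas are
    combined together with their parameters. *)
Definition valuation (a : nat -> nat + S) (e : nat -> S) (n : nat) : S :=
  match a n with inl i => e i | inr c => c end.

(** Predicates of environments rather than of elements, because a quantifier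
    then only shifts the slots; separation and replacement use slots 0 and 1. *)
Definition definable P : Prop :=
  exists p a, forall e, P e <-> sat (mem (z:=S)) (valuation a e) p.

Definition definable_term t : Prop :=
  definable (fun e => e 0 = t (fun n => e (Datatypes.S n))).

Lemma definable_iff P Q : (forall e, P e <-> Q e) -> definable Q -> definable P.
Proof.
  intros H (p & a & K). exists p, a. intro e. rewrite H. apply K.
Qed.

Lemma definable_shift P (f : nat -> nat) :
  definable P -> definable (fun e => P (fun n => e (f n))).
Proof.
  intros (p & a & K).
  exists p, (fun n => match a n with inl i => inl (f i) | inr c => inr c end).
  intro e. rewrite K.
  replace (valuation a (fun n => e (f n))) with
    (valuation (fun n => match a n with inl i => inl (f i) | inr c => inr c end) e);
    [tauto|].
  apply functional_extensionality. intro n. unfold valuation. now destruct (a n).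
Qed.

Lemma definable_not P : definable P -> definable (fun e => ~ P e).
Proof. intros (p & a & K). exists (fneg p), a. intro e. simpl. now rewrite K. Qed.

Lemma definable_and P Q :
  definable P -> definable Q -> definable (fun e => P e /\ Q e).
Proof.
  intros (p & a & K) (q & b & L).
  (* The variables of the two formulas are made disjoint as even and odd ones. *)
  exists (fand (rename (fun n => 2 * n) p) (rename (fun n => Datatypes.S (2 * n)) q)),
    (fun n => if Nat.even n then a (Nat.div2 n) else b (Nat.div2 n)).
  intro e. cbn [sat]. rewrite !sat_rename, K, L.
  match goal with |- _ <-> sat _ ?v _ /\ sat _ ?w _ =>
    replace v with (valuation a e); [replace w with (valuation b e); [tauto|]|] end;
  apply functional_extensionality; intro n; unfold valuation.
  - rewrite Nat.even_succ, Nat.odd_mul, Nat.div2_succ_double. reflexivity.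
  - rewrite Nat.even_mul, Nat.div2_double. reflexivity.
Qed.

Lemma definable_all (Q : S -> (nat -> S) -> Prop) :
  definable (fun e => Q (e 0) (fun n => e (Datatypes.S n))) ->
  definable (fun e => forall x, Q x e).
Proof.
  intros (p & a & K).
  (* The variables that read slot 0 are merged into the bound variable. *)
  exists (fall (rename (fun n => match a n with inl 0 => 0 | _ => Datatypes.S n end) p)),
    (fun n => match a n with inl i => inl (Nat.pred i) | inr c => inr c end).
  intro e. cbn [sat].
  assert (H : forall x, Q x e <-> sat (mem (z:=S)) (scons x
     (valuation (fun n => match a n with inl i => inl (Nat.pred i) | inr c => inr c end) e))
     (rename (fun n => match a n with inl 0 => 0 | _ => Datatypes.S n end) p)).
  { intro x. rewrite sat_rename. specialize (K (scons x e)). cbn [scons] in K.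
    change (fun n => e n) with e in K. rewrite K.
    match goal with |- sat _ ?v _ <-> sat _ ?w _ => replace w with v; [tauto|] end.
    apply functional_extensionality; intro n; unfold valuation.
    destruct (a n) as [[|i]|c] eqn:Ha; cbn; try rewrite Ha; reflexivity. }
  split; intros G x; apply H, G.
Qed.

Lemma definable_imp P Q :
  definable P -> definable Q -> definable (fun e => P e -> Q e).
Proof.
  intros HP HQ. apply definable_iff with (fun e => ~ (P e /\ ~ Q e)).
  - intro e. tauto.
  - auto using definable_not, definable_and.
Qed.

Lemma definable_or P Q :
  definable P -> definable Q -> definable (fun e => P e \/ Q e).
Proof.
  intros HP HQ. apply definable_iff with (fun e => ~ P e -> Q e).
  - intro e. tauto.
  - auto using definable_not, definable_imp.
Qed.

Lemma definable_equiv P Q :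
  definable P -> definable Q -> definable (fun e => P e <-> Q e).
Proof. intros HP HQ. apply definable_and; auto using definable_imp. Qed.

Lemma definable_ex (Q : S -> (nat -> S) -> Prop) :
  definable (fun e => Q (e 0) (fun n => e (Datatypes.S n))) ->
  definable (fun e => exists x, Q x e).
Proof.
  intro H. apply definable_iff with (fun e => ~ forall x, ~ Q x e).
  - intro e. split; [firstorder|]. intro K. apply NNPP. firstorder.
  - apply definable_not, definable_all, definable_not, H.
Qed.

Lemma definable_var n : definable_term (fun e => e n).
Proof. exists (feq 0 1), (fun k => inl match k with 0 => 0 | _ => Datatypes.S n end). reflexivity. Qed.

Lemma definable_const c : definable_term (fun _ => c).
Proof. exists (feq 0 1), (fun k => match k with 0 => inl 0 | _ => inr c end). reflexivity. Qed.

Definition definable2 (R : S -> S -> Prop) := definable (fun e => R (e 0) (e 1)).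

(** A definable term may stand for a variable, by quantifying over its value. *)
Lemma definable_subst2 (R : S -> S -> Prop) t u : definable2 R ->
  definable_term t -> definable_term u -> definable (fun e => R (t e) (u e)).
Proof.
  intros HR Ht Hu.
  apply definable_iff with (fun e => exists x, x = t e /\ exists y, y = u e /\ R x y).
  { intro e. split.
    - intro H. exists (t e). split; [reflexivity|]. now exists (u e).
    - now intros (x & -> & y & -> & H). }
  apply definable_ex, definable_and; [exact Ht|].
  apply definable_ex, definable_and.
  - exact (definable_shift (fun n => match n with 0 => 0 | _ => Datatypes.S n end) Hu).
  - exact (definable_shift (fun n => match n with 0 => 1 | _ => 0 end) HR).
Qed.

Lemma definable_mem t u :
  definable_term t -> definable_term u -> definable (fun e => t e ∈ u e).
Proof.
  apply definable_subst2. exists (fmem 0 1), inl. reflexivity.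
Qed.

Lemma definable_eq t u :
  definable_term t -> definable_term u -> definable (fun e => t e = u e).
Proof.
  apply definable_subst2. exists (feq 0 1), inl. reflexivity.
Qed.

Lemma definable_term2 (F : S -> S -> S) t u :
  definable (fun e => e 0 = F (e 1) (e 2)) ->
  definable_term t -> definable_term u -> definable_term (fun e => F (t e) (u e)).
Proof.
  intros HF Ht Hu.
  apply definable_iff with (fun e => exists x, x = t (fun n => e (Datatypes.S n)) /\
     exists y, y = u (fun n => e (Datatypes.S n)) /\ e 0 = F x y).
  { intro e. split.
    - intro H. exists (t (fun n => e (Datatypes.S n))). split; [reflexivity|].
      now exists (u (fun n => e (Datatypes.S n))).
    - now intros (x & -> & y & -> & H). }
  apply definable_ex, definable_and.
  - exact (definable_shift (fun n => match n with 0 => 0 | _ => Datatypes.S n end) Ht).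
  - apply definable_ex, definable_and.
    + exact (definable_shift (fun n => match n with 0 => 0 | _ => Datatypes.S (Datatypes.S n) end) Hu).
    + exact (definable_shift (fun n => match n with 0 => 2 | 1 => 1 | _ => 0 end) HF).
Qed.

(** The variables that read slot 0 become the distinguished variable of the
    schema, all others its parameters. *)
Lemma separation (P : S -> Prop) : definable (fun e => P (e 0)) ->
  forall a, exists b, forall x, x ∈ b <-> x ∈ a /\ P x.
Proof.
  intros (p & v & K) a.
  destruct (zf_separation (zfc_axioms S)
    (rename (fun n => match v n with inl 0 => 0 | _ => Datatypes.S n end) p)
    (fun n => match v n with inl _ => a | inr c => c end) a) as [b Hb].
  exists b. intro x. rewrite Hb, sat_rename.
  specialize (K (scons x (fun _ => a))). cbn [scons] in K. rewrite K.
  match goal with |- _ /\ sat _ ?v _ <-> _ /\ sat _ ?w _ => replace w with v; [tauto|] end.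
  apply functional_extensionality; intro n; unfold valuation.
  destruct (v n) as [[|i]|c] eqn:Ha; cbn; try rewrite Ha; reflexivity.
Qed.

Lemma replacement (R : S -> S -> Prop) : definable2 R ->
  forall a, (forall x, x ∈ a -> exists! y, R x y) ->
  exists b, forall y, y ∈ b <-> exists x, x ∈ a /\ R x y.
Proof.
  intros (p & v & K) a Hf.
  set (q := rename (fun n => match v n with inl 0 => 1 | inl 1 => 0
    | _ => Datatypes.S (Datatypes.S n) end) p).
  set (e := fun n => match v n with inl _ => a | inr c => c end).
  assert (H : forall x y, sat (mem (z:=S)) (scons y (scons x e)) q <-> R x y).
  { intros x y. unfold q. rewrite sat_rename.
    specialize (K (scons x (scons y (fun _ => a)))). cbn [scons] in K. rewrite K.
    match goal with |- sat _ ?v _ <-> sat _ ?w _ => replace w with v; [tauto|] end.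
    apply functional_extensionality; intro n; unfold valuation, e.
    destruct (v n) as [[|[|i]]|c] eqn:Ha; cbn; try rewrite Ha; reflexivity. }
  destruct (@zf_replacement _ _ (zfc_axioms S) q e a) as [b Hb].
  - intros x Hx. destruct (Hf x Hx) as (y & Hy & Hu). exists y. split.
    + now apply H.
    + intros y' Hy'. apply Hu, H, Hy'.
  - exists b. intro y. rewrite Hb.
    split; intros (x & Hx & Hy); exists x; split; auto; now apply H.
Qed.

End Definability.

(** * Pairs, products and functions *)

Section Pairs.
Context (S : zfc_model).
Implicit Types (a b c x y z f A B : S).

Lemma ext a b : (forall x, x ∈ a <-> x ∈ b) -> a = b.
Proof. apply (zf_extensionality (zfc_axioms S)). Qed.

Lemma the_spec (P : S -> Prop) : (exists x, P x) -> P (the P).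
Proof. apply epsilon_spec. Qed.

Lemma mem_setof (P : S -> Prop) :
  (exists a, forall x, x ∈ a <-> P x) -> forall x, x ∈ setof P <-> P x.
Proof. intro H. apply (the_spec H). Qed.

Lemma mem_upair a b x : x ∈ upair a b <-> x = a \/ x = b.
Proof. apply mem_setof, (zf_pairing (zfc_axioms S)). Qed.

Lemma upair_spec a b z : z = upair a b <-> forall x, x ∈ z <-> x = a \/ x = b.
Proof.
  split.
  - intros ->. apply mem_upair.
  - intro H. apply ext. intro x. now rewrite H, mem_upair.
Qed.

Lemma upair_inj_r a b c : upair a b = upair a c -> b = c.
Proof.
  intro H.
  assert (Hb : b ∈ upair a c) by (rewrite <- H; apply mem_upair; auto).
  assert (Hc : c ∈ upair a b) by (rewrite H; apply mem_upair; auto).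
  apply mem_upair in Hb, Hc. destruct Hb, Hc; congruence.
Qed.

Lemma opair_inj a b c d : opair a b = opair c d -> a = c /\ b = d.
Proof.
  intro H. assert (a = c).
  { assert (K : upair a a ∈ opair c d) by (rewrite <- H; apply mem_upair; auto).
    apply mem_upair in K.
    assert (L : c ∈ upair a a) by (destruct K as [-> | ->]; apply mem_upair; auto).
    apply mem_upair in L. destruct L; congruence. }
  subst c. split; [reflexivity|]. apply upair_inj_r with a.
  unfold opair in H. exact (upair_inj_r H).
Qed.

Lemma definable_opair (t u : (nat -> S) -> S) :
  definable_term t -> definable_term u -> definable_term (fun e => opair (t e) (u e)).
Proof.
  assert (K : forall t u : (nat -> S) -> S, definable_term t -> definable_term u ->
     definable_term (fun e => upair (t e) (u e))).
  { intros t' u'. apply definable_term2.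
    apply definable_iff with (fun e : nat -> S => forall x, x ∈ e 0 <-> x = e 1 \/ x = e 2).
    - intro e. apply upair_spec.
    - apply definable_all, definable_equiv; [|apply definable_or];
      (apply definable_mem || apply definable_eq); apply definable_var. }
  intros Ht Hu. unfold opair. auto.
Qed.

End Pairs.

(** Definability is proved by recursion on the syntax of the predicate. The terms
    are variables, parameters and ordered pairs; an application [ap f x] is not
    among them, because outside the domain of [f] its value is an arbitrary
    choice, so predicates meant for separation are written with the graphs of
    the functions involved. *)
Ltac definability :=
  lazymatch goal with
  | |- definable2 _ => unfold definable2; definability
  | |- definable_term (fun e => opair _ _) => apply definable_opair; definability
  | |- definable_term _ => first [apply definable_var | apply definable_const]
  | |- _ => first
     [ assumption
     | refine (definable_mem _ _); [definability | definability]
     | refine (definable_eq _ _); [definability | definability]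
     | refine (definable_not _); definability
     | refine (definable_and _ _); [definability | definability]
     | refine (definable_or _ _); [definability | definability]
     | refine (definable_equiv _ _); [definability | definability]
     | refine (definable_all _); cbv beta; definability
     | refine (definable_ex _); cbv beta; definability
     | refine (definable_imp _ _); [definability | definability]
     | match goal with H : definable2 _ |- _ =>
         refine (definable_subst2 H _ _); [definability | definability] end ]
  end.

Section SetTheory.
Context (S : zfc_model).
Implicit Types (a b c x y z f A B : S).

Lemma big_union_ex a : exists u, forall x, x ∈ u <-> exists y, y ∈ a /\ x ∈ y.
Proof. apply (zf_union (zfc_axioms S)). Qed.

Lemma union_ex a b : exists u, forall x, x ∈ u <-> x ∈ a \/ x ∈ b.
Proof.
  destruct (big_union_ex (upair a b)) as [u Hu]. exists u. intro x. rewrite Hu. split.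
  - intros (y & Hy & Hx). apply mem_upair in Hy. destruct Hy; subst; auto.
  - intros [H|H]; [exists a|exists b]; rewrite mem_upair; auto.
Qed.

Lemma insert_ex a b : exists u, forall x, x ∈ u <-> x ∈ a \/ x = b.
Proof.
  destruct (union_ex a (upair b b)) as [u Hu]. exists u. intro x.
  rewrite Hu, mem_upair. tauto.
Qed.

Lemma mem_cart A B z : z ∈ cart A B <-> exists x y, x ∈ A /\ y ∈ B /\ z = opair x y.
Proof.
  revert z. apply mem_setof.
  destruct (union_ex A B) as [u Hu].
  destruct (zf_power_set (zfc_axioms S) u) as [v Hv].
  destruct (zf_power_set (zfc_axioms S) v) as [w Hw].
  destruct (@separation S (fun z => exists x y, x ∈ A /\ y ∈ B /\ z = opair x y)) with w
    as [c Hc]; [definability|].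
  exists c. intro z. rewrite Hc. split; [tauto|].
  intros (x & y & Hx & Hy & ->). split; [|now exists x, y].
  apply Hw. intros t Ht. apply Hv. intros k Hk. apply Hu.
  apply mem_upair in Ht. destruct Ht; subst; apply mem_upair in Hk;
  destruct Hk; subst; auto.
Qed.

Lemma mem_cart_opair A B x y : opair x y ∈ cart A B <-> x ∈ A /\ y ∈ B.
Proof.
  rewrite mem_cart. split.
  - intros (x' & y' & Hx & Hy & H). apply opair_inj in H. now destruct H; subst.
  - intros [Hx Hy]. now exists x, y.
Qed.

Lemma field_ex g : exists u : S, forall t v : S, opair t v ∈ g -> t ∈ u /\ v ∈ u.
Proof.
  destruct (big_union_ex g) as [u Hu]. destruct (big_union_ex u) as [w Hw].
  exists w. intros t v H.
  assert (K : upair t v ∈ u).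
  { apply Hu. exists (opair t v). split; [exact H|]. apply mem_upair. auto. }
  split; apply Hw; exists (upair t v); (split; [exact K|apply mem_upair; auto]).
Qed.

Lemma fun_ap f A B x : is_fun f A B -> x ∈ A -> opair x (ap f x) ∈ f.
Proof.
  intros [_ H] Hx. destruct (H x Hx) as (y & Hy & _).
  apply (@the_spec S (fun y => opair x y ∈ f)). now exists y.
Qed.

Lemma fun_dom f A B x y : is_fun f A B -> opair x y ∈ f -> x ∈ A /\ y ∈ B.
Proof. intros [H _] K. apply H in K. now apply mem_cart_opair. Qed.

Lemma fun_ap_eq f A B x y : is_fun f A B -> opair x y ∈ f -> ap f x = y.
Proof.
  intros Hf K. pose proof (fun_dom Hf K) as [Hx _].
  pose proof (fun_ap Hf Hx) as L. destruct Hf as [_ H].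
  destruct (H x Hx) as (z & _ & Hz). rewrite <- (Hz _ L). now apply Hz.
Qed.

Lemma fun_ap_mem f A B x : is_fun f A B -> x ∈ A -> ap f x ∈ B.
Proof. intros Hf Hx. apply (fun_dom Hf (fun_ap Hf Hx)). Qed.

Lemma fun_indom f A B x : is_fun f A B -> (indom f x <-> x ∈ A).
Proof.
  intro Hf. split.
  - intros [y Hy]. apply (fun_dom Hf Hy).
  - intro Hx. exists (ap f x). exact (fun_ap Hf Hx).
Qed.

End SetTheory.

(** * Rank functions and dependent choice *)

Section Recursion.
Context (S : zfc_model).

(** A partial Mostowski collapse of the relation R on X, where R t u makes u a
    successor of t: its domain is closed under successors, and the value at t is
    the set of the values at the successors of t. *)
Definition collapse (X : S) (R : S -> S -> Prop) (g : S) : Prop :=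
  (forall t v v', opair t v ∈ g -> opair t v' ∈ g -> v = v') /\
  (forall t v, opair t v ∈ g -> t ∈ X) /\
  (forall t v u, opair t v ∈ g -> u ∈ X -> R t u -> exists w, opair u w ∈ g /\ w ∈ v) /\
  (forall t v w, opair t v ∈ g -> w ∈ v -> exists u, u ∈ X /\ R t u /\ opair u w ∈ g).

(** Foundation applied to the set of values at which two collapses disagree: the
    elements of a minimal such value are values at successors, where the two
    collapses agree. *)
Lemma collapse_agree X R g g' t v v' : collapse X R g -> collapse X R g' ->
  opair t v ∈ g -> opair t v' ∈ g' -> v = v'.
Proof.
  intros (_ & _ & D1 & C1) (F2 & _ & D2 & C2) H H'. apply NNPP. intro N.
  destruct (field_ex g) as [u Hu].
  destruct (@separation S (fun v => exists t v', opair t v ∈ g /\ opair t v' ∈ g' /\ v <> v'))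
    with u as [b Hb]; [definability|].
  destruct (zf_foundation (zfc_axioms S) (a:=b)) as (m & Hm & Hmin).
  { exists v. apply Hb. split; [eapply Hu, H|]. now exists t, v'. }
  apply Hb in Hm. destruct Hm as (_ & s & m' & K & K' & Nm).
  apply Nm. apply ext. intro w.
  assert (A : forall x w w', w ∈ m -> opair x w ∈ g -> opair x w' ∈ g' -> w = w').
  { intros x w1 w2 Hw L L'. apply NNPP. intro Nw. apply Hmin. exists w1.
    split; [exact Hw|]. apply Hb. split; [eapply Hu, L|]. now exists x, w2. }
  split; intro Hw.
  - destruct (C1 _ _ _ K Hw) as (x & HxX & Rx & Hx).
    destruct (D2 _ _ _ K' HxX Rx) as (w' & Hx' & Hw').
    now rewrite (A _ _ _ Hw Hx Hx').
  - destruct (C2 _ _ _ K' Hw) as (x & HxX & Rx & Hx).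
    destruct (D1 _ _ _ K HxX Rx) as (w' & Hx' & Hw').
    now rewrite <- (A _ _ _ Hw' Hx' Hx).
Qed.

(** The union g of all partial collapses is again one, by uniqueness. A point
    whose successors all lie in the domain of g lies in it too, since g could
    otherwise be extended by that point. Thus the points outside the domain form
    a set without R-minimal element; this is the ill-founded part of R. *)
Lemma collapse_well_founded_part X R : definable2 R ->
  exists g, collapse X R g /\
    forall t, t ∈ X -> ~ indom g t -> exists u, u ∈ X /\ R t u /\ ~ indom g u.
Proof.
  intro HR.
  destruct (@separation S (fun t => exists v g, collapse X R g /\ opair t v ∈ g)) with X
    as [D HD]; [unfold collapse; definability|].
  destruct (@replacement S (fun t z => exists v g, collapse X R g /\ opair t v ∈ g
     /\ z = opair t v)) with D as [g Hg]; [unfold collapse; definability| |].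
  { intros t Ht. apply HD in Ht. destruct Ht as (_ & v & g & Hg & Hv).
    exists (opair t v). split; [now exists v, g|].
    intros z (v2 & g2 & Hg2 & Hv2 & ->). f_equal. exact (collapse_agree Hg Hg2 Hv Hv2). }
  assert (Hgm : forall t v, opair t v ∈ g <-> exists g', collapse X R g' /\ opair t v ∈ g').
  { intros t v. rewrite Hg. split.
    - intros (t' & _ & v' & g' & Hg' & Hv' & E). apply opair_inj in E. destruct E; subst.
      now exists g'.
    - intros (g' & Hg' & Hv'). exists t. split.
      + apply HD. split; [apply Hg' in Hv'; exact Hv'|]. now exists v, g'.
      + now exists v, g'. }
  assert (Cg : collapse X R g).
  { split; [|split; [|split]].
    - intros t v v' H H'. apply Hgm in H, H'. destruct H as (g1 & H1 & K1).
      destruct H' as (g2 & H2 & K2). exact (collapse_agree H1 H2 K1 K2).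
    - intros t v H. apply Hgm in H. destruct H as (g1 & H1 & K1). eapply H1, K1.
    - intros t v u H Hu Ru. apply Hgm in H. destruct H as (g1 & H1 & K1).
      destruct (proj1 (proj2 (proj2 H1)) _ _ _ K1 Hu Ru) as (w & Hw & K).
      exists w. split; [|exact K]. apply Hgm. now exists g1.
    - intros t v w H Hw. apply Hgm in H. destruct H as (g1 & H1 & K1).
      destruct (proj2 (proj2 (proj2 H1)) _ _ _ K1 Hw) as (u & Hu & Ru & K).
      exists u. split; [exact Hu|]. split; [exact Ru|]. apply Hgm. now exists g1. }
  exists g. split; [exact Cg|]. intros t Ht Nt. apply NNPP. intro N.
  assert (A : forall u, u ∈ X -> R t u -> exists w, opair u w ∈ g).
  { intros u Hu Ru. apply NNPP. intro K. apply N. now exists u. }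
  destruct Cg as (F & DX & Dn & C).
  destruct (field_ex g) as [fld Hfld].
  destruct (@separation S (fun w => exists u, u ∈ X /\ R t u /\ opair u w ∈ g)) with fld
    as [v Hv]; [definability|].
  destruct (insert_ex g (opair t v)) as [g' Hg'].
  apply Nt. exists v. apply Hgm. exists g'. split; [|apply Hg'; auto].
  assert (Hg'' : forall s w, opair s w ∈ g' -> opair s w ∈ g \/ s = t /\ w = v).
  { intros s w H. apply Hg' in H. destruct H as [H|H]; [auto|]. right.
    now apply opair_inj. }
  split; [|split; [|split]].
  - intros s w w' H H'. apply Hg'' in H, H'.
    destruct H as [H|[-> ->]], H' as [H'|[E' E'']]; subst; eauto;
    exfalso; apply Nt; eexists; eassumption.
  - intros s w H. apply Hg'' in H. destruct H as [H|[-> ->]]; eauto.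
  - intros s w u H Hu Ru. apply Hg'' in H. destruct H as [H|[-> ->]].
    + destruct (Dn _ _ _ H Hu Ru) as (k & Hk & K). exists k. rewrite Hg'. auto.
    + destruct (A u Hu Ru) as [k Hk]. exists k. rewrite Hg'. split; [auto|].
      apply Hv. split; [eapply Hfld, Hk|]. now exists u.
  - intros s w k H Hk. apply Hg'' in H. destruct H as [H|[-> ->]].
    + destruct (C _ _ _ H Hk) as (u & Hu & Ru & K). exists u. rewrite Hg'. auto.
    + apply Hv in Hk. destruct Hk as (_ & u & Hu & Ru & K). exists u. rewrite Hg'. auto.
Qed.

(** A descending R-sequence given by its set of terms instead of an enumeration.
    Choice yields a selector of R-successors, and O is the orbit of t0 under the
    selector. Any two elements of the orbit of a single function are comparable
    under reachability, and reachability implies Q up to equality. This avoids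
    recursion along the natural numbers. *)
Lemma dependent_choice (Y t0 : S) (R Q : S -> S -> Prop) :
  definable2 R -> definable2 Q -> t0 ∈ Y ->
  (forall t, t ∈ Y -> exists u, u ∈ Y /\ R t u) ->
  (forall t u, R t u -> Q t u) ->
  (forall t u v, t ∈ Y -> u ∈ Y -> v ∈ Y -> Q t u -> Q u v -> Q t v) ->
  exists O, O ⊆ Y /\ t0 ∈ O /\ (forall t, t ∈ O -> exists u, u ∈ O /\ R t u) /\
    forall t u, t ∈ O -> u ∈ O -> t = u \/ Q t u \/ Q u t.
Proof.
  intros HR HQ H0 Hnext HRQ Qtrans.
  destruct (@replacement S (fun t z => forall w, w ∈ z <->
     exists u, u ∈ Y /\ R t u /\ w = opair t u)) with Y as [F HF]; [definability| |].
  { intros t Ht.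
    destruct (@separation S (fun w => exists u, u ∈ Y /\ R t u /\ w = opair t u))
      with (cart Y Y) as [z Hz]; [definability|].
    assert (Hz' : forall w, w ∈ z <-> exists u, u ∈ Y /\ R t u /\ w = opair t u).
    { intro w. rewrite Hz. split; [tauto|]. intros (u & Hu & Ru & ->).
      split; [now apply mem_cart_opair|]. now exists u. }
    exists z. split; [exact Hz'|]. intros z' K. apply ext. intro w. now rewrite Hz', K. }
  destruct (zf_choice (zfc_axioms S) (a:=F)) as [C HC].
  { intros z Hz. apply HF in Hz. destruct Hz as (t & Ht & Hz).
    destruct (Hnext t Ht) as (u & Hu & Ru). exists (opair t u). apply Hz. now exists u. }
  { intros z z' w Hz Hz' Hw Hw'. apply HF in Hz, Hz'.
    destruct Hz as (t & Ht & Hz), Hz' as (t' & Ht' & Hz').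
    pose proof (proj1 (Hz _) Hw) as (u & _ & _ & E).
    pose proof (proj1 (Hz' _) Hw') as (u' & _ & _ & E').
    rewrite E in E'. apply opair_inj in E'. destruct E' as [-> _].
    apply ext. intro k. now rewrite Hz, Hz'. }
  (* [nx] is the selector, [desc t u] says that u is reachable from t. *)
  pose (nx := fun t u => t ∈ Y /\ u ∈ Y /\ R t u /\ opair t u ∈ C).
  assert (nx_ex : forall t, t ∈ Y -> exists u, nx t u /\ forall u', nx t u' -> u' = u).
  { intros t Ht.
    destruct (@separation S (fun w => exists u, u ∈ Y /\ R t u /\ w = opair t u))
      with (cart Y Y) as [z Hz]; [definability|].
    assert (Hz' : forall w, w ∈ z <-> exists u, u ∈ Y /\ R t u /\ w = opair t u).
    { intro w. rewrite Hz. split; [tauto|]. intros (u & Hu & Ru & ->).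
      split; [now apply mem_cart_opair|]. now exists u. }
    destruct (HC z) as (w & (Hw & HwC) & Hu); [apply HF; now exists t|].
    apply Hz' in Hw. destruct Hw as (u & HuY & Ru & ->). exists u. split; [now split|].
    intros u' (_ & Hu' & Ru' & HuC'). symmetry.
    refine (proj2 (opair_inj (Hu (opair t u') _))). split; [|exact HuC'].
    apply Hz'. now exists u'. }
  pose (desc := fun t u => u ∈ Y /\
     forall Z, t ∈ Z -> (forall x y, x ∈ Z -> nx x y -> y ∈ Z) -> u ∈ Z).
  assert (Hnx : definable2 nx) by (unfold nx; definability).
  assert (Hdesc : definable2 desc) by (unfold desc; definability).
  assert (nx_ex' : forall t, t ∈ Y -> exists u, nx t u).
  { intros t Ht. destruct (nx_ex t Ht) as (u & Hu & _). now exists u. }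
  assert (nx_uniq : forall t u u', nx t u -> nx t u' -> u = u').
  { intros t u u' H H'. destruct (nx_ex t) as (w & _ & Hw); [apply H|].
    rewrite (Hw _ H). symmetry. auto. }
  assert (ind : forall (P : S -> Prop) t, definable (fun e => P (e 0)) -> t ∈ Y -> P t ->
     (forall x y, P x -> nx x y -> P y) -> forall u, desc t u -> P u).
  { intros P t HP Ht Pt Pstep u [_ Hu]. destruct (separation HP Y) as [Z HZ].
    apply HZ, Hu.
    - now apply HZ.
    - intros x y Hx Hxy. apply HZ in Hx. apply HZ. split; [apply Hxy|].
      apply Pstep with x; tauto. }
  assert (drefl : forall t, t ∈ Y -> desc t t) by (intros t Ht; now split).
  assert (dstep : forall t u v, desc t u -> nx u v -> desc t v).
  { intros t u v [_ Hu] Huv. split; [apply Huv|]. intros Z HZ K. exact (K u v (Hu Z HZ K) Huv). }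
  assert (dcase : forall t u, t ∈ Y -> desc t u -> u = t \/ exists t', nx t t' /\ desc t' u).
  { intros t u Ht Hu.
    refine (@ind (fun x => x = t \/ exists t', nx t t' /\ desc t' x) t _ Ht _ _ u Hu).
    - definability.
    - auto.
    - intros x y [->|(t' & Ht' & Hx)] Hxy; right.
      + exists y. split; [exact Hxy|]. apply drefl, Hxy.
      + exists t'. split; [exact Ht'|exact (dstep _ _ _ Hx Hxy)]. }
  assert (dY : forall t u, desc t u -> u ∈ Y) by (intros t u H; exact (proj1 H)).
  assert (dQ : forall t u, t ∈ Y -> desc t u -> t = u \/ Q t u).
  { intros t u Ht Hu. refine (proj2 (@ind (fun x => x ∈ Y /\ (t = x \/ Q t x)) t _ Ht _ _ u Hu)).
    - definability.
    - auto.
    - intros x y (HxY & Hx) Hxy. split; [apply Hxy|]. right.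
      destruct Hxy as (_ & HyY & Rxy & _). apply HRQ in Rxy.
      destruct Hx as [<-|Hx]; [exact Rxy|]. now apply Qtrans with x. }
  destruct (@separation S (fun u => desc t0 u)) with Y as [O HO]; [definability|].
  exists O. split; [|split; [|split]].
  - intros x Hx. exact (proj1 (proj1 (HO x) Hx)).
  - apply HO. auto.
  - intros t Ht. apply HO in Ht. destruct Ht as [HtY Ht].
    destruct (nx_ex' t HtY) as [u Hu]. exists u. split; [|apply Hu].
    apply HO. split; [apply Hu|]. eauto.
  - intros t u Ht Hu. apply HO in Ht, Hu. destruct Ht as [HtY Ht], Hu as [HuY Hu].
    assert (K : desc t u \/ desc u t).
    { revert u HuY Hu.
      refine (@ind (fun t => forall u, u ∈ Y -> desc t0 u -> desc t u \/ desc u t)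
        t0 _ H0 _ _ t Ht).
      - definability.
      - auto.
      - intros x y Hx Hxy u HuY Hu. destruct (Hx u HuY Hu) as [K|K].
        + destruct (dcase x u) as [->|(y' & Hy' & K')]; [apply Hxy|exact K| |].
          * right. apply dstep with x; [|exact Hxy]. apply drefl, Hxy.
          * left. now rewrite (nx_uniq _ _ _ Hxy Hy').
        + right. eauto. }
    destruct K as [K|K].
    + destruct (dQ t u HtY K); auto.
    + destruct (dQ u t HuY K); auto.
Qed.

End Recursion.

(** * Ordered monoids and their completions *)

(** The part of the axioms of a distance monoid that quantifies over elements
    only. It is inherited by every larger transitive model, whereas completeness
    and the distribution of + over infima quantify over subsets of the monoid,
    of which the larger model may have more. *)
Record ordered_monoid (S : zfc_model) (W : monoid S) : Prop := {
  om_zero : zero W ∈ W;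
  om_add : is_fun (add W) (cart W W) W;
  om_ord : ordrel W ⊆ cart W W;
  om_assoc : forall a b c, a ∈ W -> b ∈ W -> c ∈ W ->
    plus W a (plus W b c) = plus W (plus W a b) c;
  om_comm : forall a b, a ∈ W -> b ∈ W -> plus W a b = plus W b a;
  om_unit : forall a, a ∈ W -> plus W (zero W) a = a;
  om_refl : forall a, a ∈ W -> leq W a a;
  om_antisym : forall a b, a ∈ W -> b ∈ W -> leq W a b -> leq W b a -> a = b;
  om_trans : forall a b c, a ∈ W -> b ∈ W -> c ∈ W ->
    leq W a b -> leq W b c -> leq W a c;
  om_total : forall a b, a ∈ W -> b ∈ W -> leq W a b \/ leq W b a;
  om_min : forall a, a ∈ W -> leq W (zero W) a;
  om_mono : forall a b c, a ∈ W -> b ∈ W -> c ∈ W -> leq W a b ->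
    leq W (plus W c a) (plus W c b)
}.

Lemma distance_monoid_ordered (S : zfc_model) (W : monoid S) :
  distance_monoid W -> ordered_monoid W.
Proof.
  intros [H1 H2 H3 H4 H5 H6 H7 H8 H9 H10 H11 H12 _]. constructor; auto.
  intros a b c Ha Hb Hc H. now apply H12.
Qed.

Section OrderedMonoid.
Context (S : zfc_model) (W : monoid S) (HW : ordered_monoid W).

Lemma zero_mem : zero W ∈ W.
Proof. exact (om_zero HW). Qed.

Lemma le_refl a : a ∈ W -> leq W a a.
Proof. apply (om_refl HW). Qed.

Lemma zero_le a : a ∈ W -> leq W (zero W) a.
Proof. apply (om_min HW). Qed.

Lemma leq_mem a b : leq W a b -> a ∈ W /\ b ∈ W.
Proof. intro H. apply (om_ord HW) in H. now apply mem_cart_opair. Qed.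

Lemma le_trans b a c : leq W a b -> leq W b c -> leq W a c.
Proof.
  intros H K. destruct (leq_mem H), (leq_mem K). now apply (om_trans HW) with b.
Qed.

Lemma plus_graph a b : a ∈ W -> b ∈ W -> opair (opair a b) (plus W a b) ∈ add W.
Proof. intros Ha Hb. apply (fun_ap (om_add HW)). now apply mem_cart_opair. Qed.

Lemma plus_mem a b : a ∈ W -> b ∈ W -> plus W a b ∈ W.
Proof. intros Ha Hb. apply (fun_ap_mem (om_add HW)). now apply mem_cart_opair. Qed.

Lemma plus_le a a' b b' : leq W a a' -> leq W b b' -> leq W (plus W a b) (plus W a' b').
Proof.
  intros H K. destruct (leq_mem H), (leq_mem K).
  apply le_trans with (plus W a b'); [now apply (om_mono HW)|].
  rewrite (om_comm HW (a:=a)), (om_comm HW (a:=a')); auto. now apply (om_mono HW).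
Qed.

Lemma plus_zero a : a ∈ W -> plus W a (zero W) = a.
Proof.
  intro Ha. rewrite (om_comm HW); auto using zero_mem. now apply (om_unit HW).
Qed.

Lemma le_plus_l a b : a ∈ W -> b ∈ W -> leq W a (plus W a b).
Proof.
  intros Ha Hb. rewrite <- (plus_zero Ha) at 1.
  apply plus_le; [now apply le_refl|now apply zero_le].
Qed.

Lemma le_plus_r a b : a ∈ W -> b ∈ W -> leq W b (plus W a b).
Proof. intros Ha Hb. rewrite (om_comm HW); auto. now apply le_plus_l. Qed.

Lemma positive_mem a : positive W a -> a ∈ W.
Proof. intro H. exact (proj1 H). Qed.

Lemma positive_iff a : a ∈ W -> (positive W a <-> ~ leq W a (zero W)).
Proof.
  intro Ha. split.
  - intros [_ N] H. apply N. apply (om_antisym HW); auto using zero_mem, zero_le.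
  - intro N. split; [exact Ha|]. intros ->. now apply N, le_refl.
Qed.

Lemma positive_min a b : positive W a -> positive W b ->
  exists c, positive W c /\ leq W c a /\ leq W c b.
Proof.
  intros Ha Hb. destruct (om_total HW (positive_mem Ha) (positive_mem Hb)).
  - exists a. auto using le_refl, positive_mem.
  - exists b. auto using le_refl, positive_mem.
Qed.

Context (HC : continuous_at0 W).

Lemma lower_bound_sums l : l ∈ W ->
  (forall a b, positive W a -> positive W b -> leq W l (plus W a b)) -> l = zero W.
Proof.
  intros Hl H. apply (om_antisym HW); auto using zero_mem, zero_le.
  apply HC; [exact Hl|]. intros x (a & b & Ha & Hb & ->). auto.
Qed.

(** If w < k + k for all positive k then w is a lower bound of all sums a + b,
    because such a sum is at least k + k for k the smaller of a and b. *)
Lemma halving w : positive W w -> exists k, positive W k /\ leq W (plus W k k) w.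
Proof.
  intro Hw. apply NNPP. intro N. apply (proj2 Hw). apply lower_bound_sums; [apply Hw|].
  intros a b Ha Hb. destruct (positive_min Ha Hb) as (c & Hc & Hca & Hcb).
  apply le_trans with (plus W c c); [|now apply plus_le].
  destruct (om_total HW (a:=w) (b:=plus W c c)); auto using positive_mem, plus_mem.
  exfalso. apply N. now exists c.
Qed.

Lemma halving_le w v : positive W w -> positive W v ->
  exists k, positive W k /\ leq W (plus W k k) w /\ leq W k v.
Proof.
  intros Hw Hv. destruct (positive_min Hw Hv) as (c & Hc & Hcw & Hcv).
  destruct (halving Hc) as (k & Hk & Hkc). exists k. split; [exact Hk|]. split.
  - now apply le_trans with c.
  - apply le_trans with c; [|exact Hcv]. apply le_trans with (plus W k k); [|exact Hkc].
    apply le_plus_l; apply Hk.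
Qed.

(** Continuity at 0 also prevents w from being the least positive element, a
    lower bound of all sums. Halving does not give this: in a monoid with max as
    addition, w itself is a half of w. *)
Lemma smaller w : positive W w -> exists k, positive W k /\ leq W k w /\ ~ leq W w k.
Proof.
  intro Hw. apply NNPP. intro N. apply (proj2 Hw). apply lower_bound_sums; [apply Hw|].
  intros a b Ha Hb. apply le_trans with a.
  - apply NNPP. intro K. apply N. exists a. split; [exact Ha|]. split; [|exact K].
    destruct (om_total HW (positive_mem Hw) (positive_mem Ha)); tauto.
  - apply le_plus_l; apply positive_mem; assumption.
Qed.

Lemma zero_of_le_positive a : a ∈ W -> (forall w, positive W w -> leq W a w) -> a = zero W.
Proof.
  intros Ha H. apply lower_bound_sums; [exact Ha|]. intros b c Hb Hc.
  apply le_trans with b; [auto|]. apply le_plus_l; apply positive_mem; assumption.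
Qed.

Context (Wb : monoid S) (HB : is_completion W Wb).

Lemma mem_cut w v : v ∈ cut W w <-> v ∈ W /\ leq W v w.
Proof.
  revert v. apply mem_setof.
  apply (@separation S (fun v => leq W v w)). unfold leq. definability.
Qed.

Lemma cut_mem w : w ∈ W -> cut W w ∈ Wb.
Proof.
  intro Hw. apply (compl_car HB). split.
  - intros v Hv. now apply mem_cut in Hv.
  - intros v Hv H. apply mem_cut. split; [exact Hv|]. apply H; [exact Hw|].
    intros u Hu. now apply mem_cut in Hu.
Qed.

Lemma compl_sub c a : c ∈ Wb -> a ∈ c -> a ∈ W.
Proof. intros Hc Ha. apply (compl_car HB) in Hc. now apply Hc. Qed.

(** Elements of the completion are initial segments. *)
Lemma compl_down c a b : c ∈ Wb -> a ∈ c -> leq W b a -> b ∈ c.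
Proof.
  intros Hc Ha H. apply (compl_car HB) in Hc. apply Hc; [apply (leq_mem H)|].
  intros u Hu K. apply le_trans with a; auto.
Qed.

Lemma cut_le_mem c a : c ∈ Wb -> a ∈ W -> (leq Wb (cut W a) c <-> a ∈ c).
Proof.
  intros Hc Ha. rewrite (compl_ord HB); auto using cut_mem. split.
  - intro H. apply H, mem_cut. auto using le_refl.
  - intros H v Hv. apply mem_cut in Hv. apply compl_down with a; tauto.
Qed.

Lemma cut_le a b : a ∈ W -> b ∈ W -> (leq Wb (cut W a) (cut W b) <-> leq W a b).
Proof. intros Ha Hb. rewrite cut_le_mem, mem_cut; auto using cut_mem. tauto. Qed.

Lemma cut_inj a b : a ∈ W -> b ∈ W -> cut W a = cut W b -> a = b.
Proof.
  intros Ha Hb H. apply (om_antisym HW); auto; apply cut_le; auto; rewrite H;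
  apply cut_le; auto using le_refl.
Qed.

Lemma compl_leq_mem c c' : leq Wb c c' -> c ∈ Wb /\ c' ∈ Wb.
Proof. intro H. apply (compl_ord_sub HB) in H. now apply mem_cart_opair. Qed.

Lemma compl_refl c : c ∈ Wb -> leq Wb c c.
Proof. intro H. apply (compl_ord HB); auto. now intros x Hx. Qed.

Lemma compl_trans b a c : leq Wb a b -> leq Wb b c -> leq Wb a c.
Proof.
  intros H K. destruct (compl_leq_mem H), (compl_leq_mem K).
  apply (compl_ord HB) in H; auto. apply (compl_ord HB) in K; auto.
  apply (compl_ord HB); auto. intros x Hx. auto.
Qed.

Lemma compl_antisym a b : leq Wb a b -> leq Wb b a -> a = b.
Proof.
  intros H K. destruct (compl_leq_mem H).
  apply (compl_ord HB) in H; auto. apply (compl_ord HB) in K; auto.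
  apply ext. intro x. split; auto.
Qed.

Lemma compl_zero_mem : zero Wb ∈ Wb.
Proof. rewrite (compl_zero HB). apply cut_mem, zero_mem. Qed.

Lemma compl_zero_le c : c ∈ Wb -> leq Wb (zero Wb) c.
Proof.
  intro Hc. rewrite (compl_zero HB). apply cut_le_mem; [exact Hc|apply zero_mem|].
  apply (compl_car HB) in Hc. apply Hc; [apply zero_mem|].
  intros u Hu _. now apply zero_le.
Qed.

Lemma compl_total c a : c ∈ Wb -> a ∈ W -> leq Wb c (cut W a) \/ leq Wb (cut W a) c.
Proof.
  intros Hc Ha. rewrite cut_le_mem by auto. rewrite (compl_ord HB) by auto using cut_mem.
  destruct (classic (a ∈ c)) as [H|H]; [auto|]. left. intros v Hv.
  pose proof (compl_sub Hc Hv). apply mem_cut. split; [assumption|].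
  destruct (om_total HW (a:=v) (b:=a)); auto. exfalso. apply H. now apply compl_down with v.
Qed.

Lemma compl_plus_mem a b : a ∈ Wb -> b ∈ Wb -> plus Wb a b ∈ Wb.
Proof. intros Ha Hb. apply (compl_add HB Ha Hb). Qed.

Lemma compl_plus_le a a' b b' :
  leq Wb a a' -> leq Wb b b' -> leq Wb (plus Wb a b) (plus Wb a' b').
Proof.
  intros H K. destruct (compl_leq_mem H), (compl_leq_mem K).
  apply (compl_add HB (a:=a') (b:=b')); auto using compl_plus_mem.
  intros u (x & y & Hx & Hy & Hax & Hby & ->).
  apply (compl_add HB (a:=a) (b:=b)); auto. exists x, y.
  do 2 (split; [assumption|]). split; [now apply compl_trans with a'|].
  split; [now apply compl_trans with b'|reflexivity].
Qed.

(** Addition in the completion is an infimum over upper approximations by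
    cuts; between two cuts the infimum is attained at the cuts themselves. *)
Lemma cut_plus a b : a ∈ W -> b ∈ W -> plus Wb (cut W a) (cut W b) = cut W (plus W a b).
Proof.
  intros Ha Hb. apply compl_antisym.
  - apply (compl_add HB); auto using cut_mem. exists a, b.
    auto 10 using compl_refl, cut_mem.
  - apply (compl_add HB); auto using cut_mem, plus_mem.
    intros u (x & y & Hx & Hy & Hax & Hby & ->). apply cut_le; auto using plus_mem.
    apply plus_le; apply cut_le; auto.
Qed.

Lemma positive_cut a : positive W a -> positive Wb (cut W a).
Proof.
  intros [Ha N]. split; [auto using cut_mem|]. rewrite (compl_zero HB). intro E.
  apply N, cut_inj; auto using zero_mem.
Qed.

(** W is coinitial in its completion: a nonzero cut has a nonzero element. *)
Lemma positive_below c : positive Wb c -> exists a, positive W a /\ leq Wb (cut W a) c.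
Proof.
  intros [Hc N]. apply NNPP. intro K. apply N. apply compl_antisym; [|now apply compl_zero_le].
  apply (compl_ord HB); [exact Hc|apply compl_zero_mem|]. intros v Hv.
  rewrite (compl_zero HB), mem_cut. pose proof (compl_sub Hc Hv). split; [assumption|].
  apply NNPP. intro L. apply K. exists v. split; [now apply positive_iff|].
  now apply cut_le_mem.
Qed.

Lemma compl_zero_of_le_positive c : c ∈ Wb ->
  (forall w, positive W w -> leq Wb c (cut W w)) -> leq Wb c (zero Wb).
Proof.
  intros Hc H. apply (compl_ord HB); [exact Hc|apply compl_zero_mem|]. intros v Hv.
  pose proof (compl_sub Hc Hv) as HvW.
  rewrite (zero_of_le_positive HvW).
  - rewrite (compl_zero HB). apply mem_cut. split; [|apply le_refl]; exact zero_mem.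
  - intros w Hw. specialize (H w Hw). apply (compl_ord HB) in H;
    auto using cut_mem, positive_mem. apply H, mem_cut in Hv. apply Hv.
Qed.

Lemma compl_continuous :
  is_inf Wb (fun u => exists a b, positive Wb a /\ positive Wb b /\ u = plus Wb a b) (zero Wb).
Proof.
  split; [apply compl_zero_mem|]. split.
  - intros x (a & b & Ha & Hb & ->). apply compl_zero_le, compl_plus_mem; [apply Ha|apply Hb].
  - intros l Hl H. apply compl_zero_of_le_positive; [exact Hl|]. intros w Hw.
    destruct (halving Hw) as (k & Hk & Hkw).
    apply compl_trans with (plus Wb (cut W k) (cut W k)).
    + apply H. exists (cut W k), (cut W k). auto using positive_cut.
    + rewrite cut_plus by (apply Hk). apply cut_le; [apply plus_mem; apply Hk|apply Hw|exact Hkw].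
Qed.

End OrderedMonoid.

(** * Metric spaces and their Cauchy completions *)

(** Sums and distances are compared through the graphs of the operations, which
    makes these predicates first-order in all their arguments. *)
Definition sum_le (S : zfc_model) (W : monoid S) (a b c : S) : Prop :=
  exists s, opair (opair a b) s ∈ add W /\ leq W s c.

Definition dist_le (S : zfc_model) (W : monoid S) (M : mspace S) (x y r : S) : Prop :=
  exists d, opair (opair x y) d ∈ dfun M /\ leq W d r.

Lemma sum_le_iff (S : zfc_model) (W : monoid S) (HW : ordered_monoid W) a b c :
  a ∈ W -> b ∈ W -> (sum_le W a b c <-> leq W (plus W a b) c).
Proof.
  intros Ha Hb. split.
  - intros (s & Hs & H). unfold plus, ap2. now rewrite (fun_ap_eq (om_add HW) Hs).
  - intro H. exists (plus W a b). split; [|exact H]. now apply plus_graph.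
Qed.

Section Metric.
Context (S : zfc_model) (W : monoid S) (HW : ordered_monoid W).
Context (M : mspace S) (HM : metric_space W M).

Lemma dist_graph x y : x ∈ M -> y ∈ M -> opair (opair x y) (dist M x y) ∈ dfun M.
Proof. intros Hx Hy. apply (fun_ap (ms_fun HM)). now apply mem_cart_opair. Qed.

Lemma dist_mem x y : x ∈ M -> y ∈ M -> dist M x y ∈ W.
Proof. intros Hx Hy. apply (fun_ap_mem (ms_fun HM)). now apply mem_cart_opair. Qed.

Lemma dist_eq x y d : opair (opair x y) d ∈ dfun M -> dist M x y = d.
Proof. intro H. exact (fun_ap_eq (ms_fun HM) H). Qed.

Lemma dist_le_iff x y r :
  x ∈ M -> y ∈ M -> (dist_le W M x y r <-> leq W (dist M x y) r).
Proof.
  intros Hx Hy. split.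
  - intros (d & Hd & H). now rewrite (dist_eq Hd).
  - intro H. exists (dist M x y). split; [|exact H]. now apply dist_graph.
Qed.

Lemma dist_self x : x ∈ M -> dist M x x = zero W.
Proof. intro Hx. destruct (proj2 (ms_sep HM Hx Hx) eq_refl) as [[_ H]|[_ H]]; auto. Qed.

Lemma dist_tri y x z a b : x ∈ M -> y ∈ M -> z ∈ M ->
  leq W (dist M x y) a -> leq W (dist M y z) b -> leq W (dist M x z) (plus W a b).
Proof.
  intros Hx Hy Hz H K.
  apply (le_trans HW) with (plus W (dist M x y) (dist M y z)); [now apply (ms_tri HM)|].
  now apply plus_le.
Qed.

Lemma eq_of_dist_zero x y : x ∈ M -> y ∈ M ->
  dist M x y = zero W -> dist M y x = zero W -> x = y.
Proof.
  intros Hx Hy H K. apply (ms_sep HM); auto. left. rewrite H, K.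
  split; [|reflexivity]. apply (le_refl HW), (zero_mem HW).
Qed.

Context (HC : continuous_at0 W) (Wb : monoid S) (HB : is_completion W Wb).
Context (M' : mspace S) (HR : regarded W Wb M M').

Lemma cauchy_entry p b y : cauchy_seq Wb M' p -> opair b y ∈ p ->
  positive Wb b /\ y ∈ M /\ ap p b = y.
Proof.
  intros (A & HA & _ & Hp & _) H. pose proof (fun_dom Hp H) as [Hb Hy].
  rewrite (proj1 HR) in Hy. split; [auto|]. split; [exact Hy|exact (fun_ap_eq Hp H)].
Qed.

Lemma cauchy_indom p b : cauchy_seq Wb M' p -> indom p b -> opair b (ap p b) ∈ p.
Proof.
  intros Hp [y Hy]. now destruct (cauchy_entry Hp Hy) as (_ & _ & ->).
Qed.

Lemma cauchy_close p b y b' y' : cauchy_seq Wb M' p -> opair b y ∈ p -> opair b' y' ∈ p ->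
  leq Wb (cut W (dist M y y')) (plus Wb b b').
Proof.
  intros Hc H H'. pose proof Hc as (A & HA & _ & Hp & Hd).
  destruct (cauchy_entry Hc H) as (_ & Hy & E), (cauchy_entry Hc H') as (_ & Hy' & E').
  rewrite <- (proj2 (proj2 HR)) by assumption. rewrite <- E, <- E'.
  apply Hd; [apply (fun_dom Hp H)|apply (fun_dom Hp H')].
Qed.

(** Otherwise some positive w would be below the whole domain of p, hence below
    all sums of two elements of the domain, whose infimum is 0. *)
Lemma cauchy_small p e : cauchy_seq Wb M' p -> positive Wb e ->
  exists b y, opair b y ∈ p /\ leq Wb b e.
Proof.
  intros (A & HA & Hinf & Hp & _) He.
  destruct (positive_below HW HB He) as (w & Hw & Hwe).
  apply NNPP. intro N. apply (proj2 (positive_cut HW HB Hw)).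
  apply (compl_antisym HB); [|apply (compl_zero_le HW HB), (cut_mem HB), Hw].
  assert (K : forall a, a ∈ A -> leq Wb (cut W w) a).
  { intros a Ha. destruct (compl_total HW HB (c:=a) (a:=w)); auto.
    - exact (proj1 (HA a Ha)).
    - apply Hw.
    - exfalso. apply N. exists a, (ap p a). split; [exact (fun_ap Hp Ha)|].
      now apply (compl_trans HB) with (cut W w). }
  apply Hinf; [apply (cut_mem HB), Hw|]. intros x (a & b & Ha & Hb & ->).
  rewrite <- (plus_zero HW (a:=w)) by (apply Hw).
  rewrite <- (cut_plus HW HB) by (apply Hw || apply (zero_mem HW)).
  apply (compl_plus_le HB); [auto|]. rewrite <- (compl_zero HB).
  apply (compl_zero_le HW HB), (HA b Hb).
Qed.

Lemma seq_dist_le p q r k : cauchy_seq Wb M' p -> cauchy_seq Wb M' q ->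
  seq_dist Wb M' p q r -> k ∈ Wb ->
  (forall c, positive Wb c -> exists a y b z, opair a y ∈ p /\ opair b z ∈ q /\
     leq Wb a c /\ leq Wb b c /\ leq Wb (cut W (dist M y z)) k) ->
  leq Wb r k.
Proof.
  intros Hp Hq Hr Hk H. apply (proj2 (proj2 Hr)); [exact Hk|].
  intros v (c & Hc & Hv). destruct (H c Hc) as (a & y & b & z & Ha & Hb & Hac & Hbc & K).
  apply (compl_trans HB) with (cut W (dist M y z)); [|exact K].
  apply Hv. exists a, b.
  destruct (cauchy_entry Hp Ha) as (_ & Hy & ->), (cauchy_entry Hq Hb) as (_ & Hz & ->).
  split; [now exists y|]. split; [now exists z|]. do 2 (split; [assumption|]).
  symmetry. now apply HR.
Qed.

(** The values of W between k and k' bridge the gap between an infimum and its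
    members: if no pair of entries beyond c were at distance at most k', the cut
    of k' would be a lower bound of these distances, so the distance r of the
    sequences would be at least k' > k. The infimum itself is the set v of all
    elements of W that are below all these distances. *)
Lemma seq_dist_attained p q r k k' c : cauchy_seq Wb M' p -> cauchy_seq Wb M' q ->
  seq_dist Wb M' p q r -> k ∈ W -> k' ∈ W -> leq Wb r (cut W k) -> ~ leq W k' k ->
  positive Wb c -> exists a y b z, opair a y ∈ p /\ opair b z ∈ q /\
     leq Wb a c /\ leq Wb b c /\ leq W (dist M y z) k'.
Proof.
  intros Hp Hq Hr Hk Hk' Hrk Hkk' Hc. apply NNPP. intro N.
  destruct (@separation S (fun w => forall a y b z d, opair a y ∈ p -> opair b z ∈ q ->
     leq Wb a c -> leq Wb b c -> opair (opair y z) d ∈ dfun M -> leq W w d)) with (car W)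
    as [v Hv]; [unfold leq; definability|].
  assert (HvW : v ∈ Wb).
  { apply (compl_car HB). split; [intros w Hw; now apply Hv in Hw|].
    intros w Hw K. apply Hv. split; [exact Hw|]. intros a y b z d Ha Hb Hac Hbc Hd.
    apply K.
    - rewrite <- (dist_eq Hd). apply dist_mem; [apply (cauchy_entry Hp Ha)|apply (cauchy_entry Hq Hb)].
    - intros u Hu. apply Hv in Hu. destruct Hu as [_ Hu]. now apply (Hu a y b z). }
  assert (Hvr : leq Wb v r).
  { apply Hr. exists c. split; [exact Hc|]. split; [exact HvW|]. split.
    - intros x (a & b & Ha & Hb & Hac & Hbc & ->).
      apply (cauchy_indom Hp) in Ha. apply (cauchy_indom Hq) in Hb.
      destruct (cauchy_entry Hp Ha) as (_ & Hy & _), (cauchy_entry Hq Hb) as (_ & Hz & _).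
      rewrite (proj2 (proj2 HR)) by assumption.
      apply (compl_ord HB); [exact HvW|apply (cut_mem HB); now apply dist_mem|].
      intros w Hw. apply Hv in Hw. apply mem_cut. split; [apply Hw|].
      apply (proj2 Hw a (ap p a) b (ap q b)); auto. now apply dist_graph.
    - intros l Hl K. apply (compl_ord HB); auto. intros w Hw. apply Hv.
      pose proof (compl_sub HB Hl Hw). split; [assumption|].
      intros a y b z d Ha Hb Hac Hbc Hd.
      destruct (cauchy_entry Hp Ha) as (_ & Hy & Ey), (cauchy_entry Hq Hb) as (_ & Hz & Ez).
      assert (L : leq Wb l (cut W d)).
      { apply K. exists a, b. split; [now exists y|]. split; [now exists z|].
        do 2 (split; [assumption|]). rewrite Ey, Ez, <- (dist_eq Hd). symmetry. now apply HR. }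
      apply (compl_ord HB) in L; auto.
      + apply L, mem_cut in Hw. apply Hw.
      + apply (cut_mem HB). rewrite <- (dist_eq Hd). now apply dist_mem. }
  apply Hkk'. apply (cut_le HW HB); auto.
  apply (compl_trans HB) with v; [|now apply (compl_trans HB) with r].
  apply (cut_le_mem HW HB); auto. apply Hv. split; [exact Hk'|].
  intros a y b z d Ha Hb Hac Hbc Hd.
  destruct (cauchy_entry Hp Ha) as (_ & Hy & Ey), (cauchy_entry Hq Hb) as (_ & Hz & Ez).
  rewrite <- (dist_eq Hd).
  destruct (om_total HW Hk' (dist_mem Hy Hz)) as [L|L]; [exact L|].
  exfalso. apply N. now exists a, y, b, z.
Qed.

Lemma seq_equiv_refl p : cauchy_seq Wb M' p -> seq_equiv Wb M' p p.
Proof.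
  intro Hp. assert (K : seq_dist Wb M' p p (zero Wb)); [|now split].
  split; [exact (compl_zero_mem HW HB)|]. split.
  - intros v (c & Hc & Hv). destruct (cauchy_small Hp Hc) as (b & y & Hb & Hbc).
    apply Hv. exists b, b. split; [now exists y|]. split; [now exists y|].
    do 2 (split; [assumption|]). destruct (cauchy_entry Hp Hb) as (_ & Hy & ->).
    rewrite (proj2 (proj2 HR)), dist_self by assumption. apply (compl_zero HB).
  - intros l Hl _. now apply (compl_zero_le HW HB).
Qed.

Lemma mem_const_seq x a z : opair a z ∈ const_seq Wb x <-> positive Wb a /\ z = x.
Proof.
  unfold const_seq. rewrite mem_setof.
  - split.
    + intros (b & Hb & E). apply opair_inj in E. now destruct E; subst.
    + intros [Ha ->]. now exists a.
  - destruct (@separation S (fun z => exists a, positive Wb a /\ z = opair a x))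
      with (cart Wb (upair x x)) as [c Hc]; [unfold positive; definability|].
    exists c. intro t. rewrite Hc. split; [tauto|]. intros (b & Hb & ->).
    split; [|now exists b]. apply mem_cart_opair. split; [apply Hb|]. apply mem_upair. auto.
Qed.

Lemma const_seq_cauchy x : x ∈ M -> cauchy_seq Wb M' (const_seq Wb x).
Proof.
  intro Hx.
  destruct (@separation S (fun a => positive Wb a)) with (car Wb) as [A HA];
    [unfold positive; definability|].
  assert (HA' : forall a, a ∈ A <-> positive Wb a).
  { intro a. rewrite HA. unfold positive. tauto. }
  assert (Hf : is_fun (const_seq Wb x) A M').
  { split.
    - intros t Ht. pose proof Ht as Ht'. unfold const_seq in Ht. rewrite mem_setof in Ht.
      + destruct Ht as (a & Ha & ->). apply mem_cart_opair. rewrite HA', (proj1 HR). auto.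
      + destruct (@separation S (fun z => exists a, positive Wb a /\ z = opair a x))
          with (const_seq Wb x) as [c Hc]; [unfold positive; definability|].
        exists c. intro u. rewrite Hc. split; [tauto|]. intros (b & Hb & ->).
        split; [|now exists b]. now apply mem_const_seq.
    - intros a Ha. exists x. split; [apply mem_const_seq; now rewrite <- HA'|].
      intros y Hy. now apply mem_const_seq in Hy. }
  exists A. split; [|split; [|split]].
  - intros a Ha. now apply HA'.
  - pose proof (compl_continuous HW HC HB) as (H1 & H2 & H3). split; [exact H1|]. split.
    + intros u (a & b & Ha & Hb & ->). apply H2. exists a, b. rewrite <- !HA'. auto.
    + intros l Hl K. apply H3; [exact Hl|]. intros u (a & b & Ha & Hb & ->).
      apply K. exists a, b. rewrite !HA'. auto.
  - exact Hf.
  - intros a b Ha Hb.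
    rewrite (fun_ap_eq (x:=a) (y:=x) Hf), (fun_ap_eq (x:=b) (y:=x) Hf)
      by (apply mem_const_seq; now rewrite <- HA').
    rewrite (proj2 (proj2 HR)), dist_self by assumption. rewrite <- (compl_zero HB).
    apply (compl_zero_le HW HB), (compl_plus_mem HB); apply HA; assumption.
Qed.

Context (Mc : mspace S) (HQ : is_cauchy_quotient Wb M' Mc).
Context (f fc : S) (Hf : non_expanding W M f) (Hfc : non_expanding Wb Mc fc).
Context (Hext : forall x c, x ∈ M -> c ∈ Mc -> is_class Wb M' (const_seq Wb x) c ->
         is_class Wb M' (const_seq Wb (ap f x)) (ap fc c)).

Lemma map_mem x : x ∈ M -> ap f x ∈ M.
Proof. apply (fun_ap_mem (proj1 Hf)). Qed.

(** The class of the constant sequence at a fixed point is sent to itself. *)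
Lemma fixed_point_to_completion x : x ∈ M -> ap f x = x ->
  exists c, c ∈ Mc /\ ap fc c = c.
Proof.
  intros Hx E. destruct (cq_all HQ (const_seq_cauchy Hx)) as (c & Hc & Hcl).
  exists c. split; [exact Hc|]. pose proof (Hext Hx Hc Hcl) as K. rewrite E in K.
  apply ext. intro q. rewrite (Hcl q). apply K.
Qed.

(** [near p x g] says that x is within g of the limit of p, without reference to
    the limit: all late entries of p are within g of x, in both directions. *)
Definition near (p x g : S) : Prop :=
  exists e, positive Wb e /\ forall b y, opair b y ∈ p -> leq Wb b e ->
    dist_le W M x y g /\ dist_le W M y x g.

Lemma near_exists p g : cauchy_seq Wb M' p -> positive W g -> exists x, x ∈ M /\ near p x g.
Proof.
  intros Hp Hg. destruct (halving HW HC Hg) as (k & Hk & Hkg).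
  destruct (cauchy_small Hp (positive_cut HW HB Hk)) as (b & x & Hb & Hbk).
  destruct (cauchy_entry Hp Hb) as (_ & Hx & _).
  exists x. split; [exact Hx|]. exists (cut W k). split; [exact (positive_cut HW HB Hk)|].
  intros b' y Hb' Hb'k. destruct (cauchy_entry Hp Hb') as (_ & Hy & _).
  assert (A : forall u v b1 b2, u ∈ M -> v ∈ M -> leq Wb b1 (cut W k) -> leq Wb b2 (cut W k) ->
    leq Wb (cut W (dist M u v)) (plus Wb b1 b2) -> dist_le W M u v g).
  { intros u v b1 b2 Hu Hv H1 H2 H. apply dist_le_iff; auto.
    apply (le_trans HW) with (plus W k k); [|exact Hkg].
    apply (cut_le HW HB); [now apply dist_mem|apply (plus_mem HW); apply Hk|].
    rewrite <- (cut_plus HW HB) by (apply Hk).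
    apply (compl_trans HB) with (plus Wb b1 b2); [exact H|]. now apply (compl_plus_le HB). }
  split; [apply (A x y b b')|apply (A y x b' b)]; auto; now apply (cauchy_close Hp).
Qed.

Lemma near_close p x y g h : cauchy_seq Wb M' p -> x ∈ M -> y ∈ M ->
  near p x g -> near p y h -> leq W (dist M x y) (plus W g h).
Proof.
  intros Hp Hx Hy (e & He & Hxe) (e' & He' & Hye).
  destruct (positive_below HW HB He) as (w & Hw & Hwe).
  destruct (positive_below HW HB He') as (w' & Hw' & Hwe').
  destruct (positive_min HW Hw Hw') as (u & Hu & Huw & Huw').
  destruct (cauchy_small Hp (positive_cut HW HB Hu)) as (b & z & Hb & Hbu).
  destruct (cauchy_entry Hp Hb) as (_ & Hz & _).
  assert (Hbw : leq Wb b e).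
  { apply (compl_trans HB) with (cut W u); [exact Hbu|].
    apply (compl_trans HB) with (cut W w); [|exact Hwe].
    apply (cut_le HW HB); [apply Hu|apply Hw|exact Huw]. }
  assert (Hbw' : leq Wb b e').
  { apply (compl_trans HB) with (cut W u); [exact Hbu|].
    apply (compl_trans HB) with (cut W w'); [|exact Hwe'].
    apply (cut_le HW HB); [apply Hu|apply Hw'|exact Huw']. }
  destruct (Hxe b z Hb Hbw) as [H _]. destruct (Hye b z Hb Hbw') as [_ K].
  apply dist_le_iff in H, K; auto. now apply (dist_tri (y:=z)).
Qed.

(** Let c be the class of p and y a point within k of c. The extended map fixes c
    and does not expand distances, so the image of y is within k of c as well;
    the entries of p that witness this are also within k of y. The strict
    inequality k < k' absorbs the passage from the infimum to an entry. *)
Lemma near_almost_fixed p c y k k' : cauchy_seq Wb M' p -> is_class Wb M' p c ->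
  c ∈ Mc -> ap fc c = c -> y ∈ M -> k ∈ W -> k' ∈ W -> ~ leq W k' k -> near p y k ->
  leq W (dist M y (ap f y)) (plus W k k') /\ leq W (dist M (ap f y) y) (plus W k' k).
Proof.
  intros Hp Hpc Hc Hfix Hy Hk Hk' Hkk' (e & He & Hnear).
  pose proof (const_seq_cauchy Hy) as Hcy.
  pose proof (map_mem Hy) as Hfy.
  pose proof (const_seq_cauchy Hfy) as Hcfy.
  destruct (cq_all HQ Hcy) as (cy & HcyM & Hcl).
  assert (Hfcy : ap fc cy ∈ Mc) by (apply (fun_ap_mem (proj1 Hfc) HcyM)).
  assert (pin : p ∈ c) by (apply Hpc; split; [exact Hp|now apply seq_equiv_refl]).
  assert (yin : const_seq Wb y ∈ cy)
    by (apply Hcl; split; [exact Hcy|now apply seq_equiv_refl]).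
  assert (fyin : const_seq Wb (ap f y) ∈ ap fc cy)
    by (apply (Hext Hy HcyM Hcl); split; [exact Hcfy|now apply seq_equiv_refl]).
  assert (Hsmall : forall d, positive Wb d -> exists b z, opair b z ∈ p /\ leq Wb b d /\ leq Wb b e).
  { intros d Hd.
    destruct (positive_below HW HB He) as (w & Hw & Hwe).
    destruct (positive_below HW HB Hd) as (w' & Hw' & Hwd).
    destruct (positive_min HW Hw Hw') as (u & Hu & Huw & Huw').
    destruct (cauchy_small Hp (positive_cut HW HB Hu)) as (b & z & Hb & Hbu).
    exists b, z. split; [exact Hb|]. split; (apply (compl_trans HB) with (cut W u); [exact Hbu|]).
    - apply (compl_trans HB) with (cut W w'); [|exact Hwd].
      apply (cut_le HW HB); [apply Hu|apply Hw'|exact Huw'].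
    - apply (compl_trans HB) with (cut W w); [|exact Hwe].
      apply (cut_le HW HB); [apply Hu|apply Hw|exact Huw]. }
  assert (D1 : leq Wb (dist Mc c cy) (cut W k)).
  { apply (seq_dist_le Hp Hcy (cq_dist HQ Hc HcyM pin yin)); [now apply (cut_mem HB)|].
    intros d Hd. destruct (Hsmall d Hd) as (b & z & Hb & Hbd & Hbe).
    pose proof (cauchy_entry Hp Hb) as (Hb0 & Hz & _).
    exists b, z, b, y. rewrite mem_const_seq. do 4 (split; [auto|]).
    apply (cut_le HW HB); [now apply dist_mem|exact Hk|].
    apply dist_le_iff; auto. now apply (Hnear b z). }
  assert (D2 : leq Wb (dist Mc cy c) (cut W k)).
  { apply (seq_dist_le Hcy Hp (cq_dist HQ HcyM Hc yin pin)); [now apply (cut_mem HB)|].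
    intros d Hd. destruct (Hsmall d Hd) as (b & z & Hb & Hbd & Hbe).
    pose proof (cauchy_entry Hp Hb) as (Hb0 & Hz & _).
    exists b, y, b, z. rewrite mem_const_seq. do 4 (split; [auto|]).
    apply (cut_le HW HB); [now apply dist_mem|exact Hk|].
    apply dist_le_iff; auto. now apply (Hnear b z). }
  assert (D3 : leq Wb (dist Mc c (ap fc cy)) (cut W k)).
  { apply (compl_trans HB) with (dist Mc c cy); [|exact D1].
    rewrite <- Hfix at 1. now apply (proj2 Hfc). }
  assert (D4 : leq Wb (dist Mc (ap fc cy) c) (cut W k)).
  { apply (compl_trans HB) with (dist Mc cy c); [|exact D2].
    rewrite <- Hfix at 1. now apply (proj2 Hfc). }
  split.
  - destruct (seq_dist_attained Hp Hcfy (cq_dist HQ Hc Hfcy pin fyin) Hk Hk' D3 Hkk' He)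
      as (a & z & b & z' & Ha & Hb & Hae & _ & Hd).
    apply mem_const_seq in Hb. destruct Hb as [_ ->].
    pose proof (cauchy_entry Hp Ha) as (_ & Hz & _).
    destruct (Hnear a z Ha Hae) as [Hn _]. apply dist_le_iff in Hn; auto.
    now apply (dist_tri (y:=z)).
  - destruct (seq_dist_attained Hcfy Hp (cq_dist HQ Hfcy Hc fyin pin) Hk Hk' D4 Hkk' He)
      as (b & z' & a & z & Hb & Ha & _ & Hae & Hd).
    apply mem_const_seq in Hb. destruct Hb as [_ ->].
    pose proof (cauchy_entry Hp Ha) as (_ & Hz & _).
    destruct (Hnear a z Ha Hae) as [_ Hn]. apply dist_le_iff in Hn; auto.
    now apply (dist_tri (y:=z)).
Qed.

End Metric.

(** * Absoluteness between transitive models *)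

Section Absoluteness.
Context (B : zfc_model) (V0 V1 : transitive_model B).
Context (h : forall x : B, V0 x -> V1 x).
Notation i := (incl h).

Lemma incl_mem x y : i x ∈ i y <-> x ∈ y.
Proof. reflexivity. Qed.

Lemma incl_inj x y : i x = i y -> x = y.
Proof.
  intro H. apply ext. intro z. rewrite <- (incl_mem z x), <- (incl_mem z y), H. reflexivity.
Qed.

(** Transitivity of V0: elements of V1 that belong to an element of V0 come from
    V0. All absoluteness below rests on this. *)
Lemma incl_down z x : z ∈ i x -> exists z0, z = i z0 /\ z0 ∈ x.
Proof.
  destruct x as [x Hx], z as [z Hz]. cbn. intro H.
  exists (exist _ z (class_trans Hx H)). split; [|exact H].
  apply (@ext (inner V1)). intro u. reflexivity.
Qed.

Lemma incl_upair a b : i (upair a b) = upair (i a) (i b).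
Proof.
  apply ext. intro z. rewrite mem_upair. split.
  - intro H. apply incl_down in H. destruct H as (z0 & -> & H). apply mem_upair in H.
    destruct H; subst; auto.
  - intros [-> | ->]; apply incl_mem, mem_upair; auto.
Qed.

Lemma incl_opair a b : i (opair a b) = opair (i a) (i b).
Proof. unfold opair. now rewrite !incl_upair. Qed.

Lemma incl_opair_mem a b f : opair (i a) (i b) ∈ i f <-> opair a b ∈ f.
Proof. now rewrite <- incl_opair. Qed.

Lemma incl_cart a b : i (cart a b) = cart (i a) (i b).
Proof.
  apply ext. intro z. rewrite mem_cart. split.
  - intro H. apply incl_down in H. destruct H as (z0 & -> & H). apply mem_cart in H.
    destruct H as (x & y & Hx & Hy & ->). exists (i x), (i y). now rewrite incl_opair.
  - intros (x & y & Hx & Hy & ->). apply incl_down in Hx, Hy.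
    destruct Hx as (x0 & -> & Hx), Hy as (y0 & -> & Hy).
    rewrite <- incl_opair. apply incl_mem. now apply mem_cart_opair.
Qed.

Lemma incl_sub a b : a ⊆ b -> i a ⊆ i b.
Proof.
  intros H x Hx. apply incl_down in Hx. destruct Hx as (x0 & -> & Hx). now apply H.
Qed.

Lemma incl_is_fun f a b : is_fun f a b -> is_fun (i f) (i a) (i b).
Proof.
  intros [Hs Hf]. split.
  - rewrite <- incl_cart. now apply incl_sub.
  - intros x Hx. apply incl_down in Hx. destruct Hx as (x0 & -> & Hx).
    destruct (Hf x0 Hx) as (y & Hy & Hu). exists (i y). split; [now apply incl_opair_mem|].
    intros z Hz.
    assert (K : z ∈ i b).
    { apply (incl_sub Hs) in Hz. rewrite incl_cart in Hz. now apply mem_cart_opair in Hz. }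
    apply incl_down in K. destruct K as (z0 & -> & K). f_equal. apply Hu.
    now apply incl_opair_mem.
Qed.

Lemma incl_ap f a b x : is_fun f a b -> x ∈ a -> i (ap f x) = ap (i f) (i x).
Proof.
  intros Hf Hx. symmetry. apply (fun_ap_eq (incl_is_fun Hf)).
  apply incl_opair_mem. exact (fun_ap Hf Hx).
Qed.

Section Monoid.
Context (W : monoid (inner V0)).
Notation W1 := (incl_monoid h W).

Lemma incl_leq a b : leq W1 (i a) (i b) <-> leq W a b.
Proof. apply incl_opair_mem. Qed.

Lemma incl_positive a : positive W1 (i a) <-> positive W a.
Proof.
  unfold positive. change (car W1) with (i W). change (zero W1) with (i (zero W)).
  rewrite incl_mem. split; intros [Ha N]; (split; [exact Ha|]); intro E; apply N.
  - now rewrite E.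
  - now apply incl_inj.
Qed.

Context (HW : ordered_monoid W).

Lemma incl_plus a b : a ∈ W -> b ∈ W -> i (plus W a b) = plus W1 (i a) (i b).
Proof.
  intros Ha Hb. unfold plus, ap2. rewrite (incl_ap (om_add HW)); [|now apply mem_cart_opair].
  now rewrite incl_opair.
Qed.

Lemma incl_ordered_monoid : ordered_monoid W1.
Proof.
  constructor.
  - apply (om_zero HW).
  - pose proof (incl_is_fun (om_add HW)) as K. now rewrite incl_cart in K.
  - pose proof (incl_sub (om_ord HW)) as K. now rewrite incl_cart in K.
  - intros a b c Ha Hb Hc. apply incl_down in Ha, Hb, Hc.
    destruct Ha as (a0 & -> & Ha), Hb as (b0 & -> & Hb), Hc as (c0 & -> & Hc).
    rewrite <- !incl_plus; auto using plus_mem. f_equal. now apply (om_assoc HW).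
  - intros a b Ha Hb. apply incl_down in Ha, Hb.
    destruct Ha as (a0 & -> & Ha), Hb as (b0 & -> & Hb).
    rewrite <- !incl_plus by auto. f_equal. now apply (om_comm HW).
  - intros a Ha. apply incl_down in Ha. destruct Ha as (a0 & -> & Ha).
    change (zero W1) with (i (zero W)). rewrite <- incl_plus; [|apply (om_zero HW)|exact Ha].
    f_equal. now apply (om_unit HW).
  - intros a Ha. apply incl_down in Ha. destruct Ha as (a0 & -> & Ha).
    apply incl_leq. now apply (om_refl HW).
  - intros a b Ha Hb H K. apply incl_down in Ha, Hb.
    destruct Ha as (a0 & -> & Ha), Hb as (b0 & -> & Hb). f_equal.
    apply (proj1 (incl_leq _ _)) in H, K. now apply (om_antisym HW).
  - intros a b c Ha Hb Hc H K. apply incl_down in Ha, Hb, Hc.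
    destruct Ha as (a0 & -> & Ha), Hb as (b0 & -> & Hb), Hc as (c0 & -> & Hc).
    apply (proj1 (incl_leq _ _)) in H, K. apply incl_leq. now apply (om_trans HW) with b0.
  - intros a b Ha Hb. apply incl_down in Ha, Hb.
    destruct Ha as (a0 & -> & Ha), Hb as (b0 & -> & Hb). rewrite !incl_leq.
    now apply (om_total HW).
  - intros a Ha. apply incl_down in Ha. destruct Ha as (a0 & -> & Ha).
    apply (proj2 (incl_leq _ _)). now apply (om_min HW).
  - intros a b c Ha Hb Hc H. apply incl_down in Ha, Hb, Hc.
    destruct Ha as (a0 & -> & Ha), Hb as (b0 & -> & Hb), Hc as (c0 & -> & Hc).
    apply (proj1 (incl_leq _ _)) in H. rewrite <- !incl_plus by auto. apply incl_leq.
    now apply (om_mono HW).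
Qed.

Lemma incl_continuous_at0 : continuous_at0 W -> continuous_at0 W1.
Proof.
  intro HC. split; [apply (om_zero HW)|]. split.
  - intros x (a & b & Ha & Hb & ->). apply (zero_le incl_ordered_monoid).
    apply (plus_mem incl_ordered_monoid); [apply Ha|apply Hb].
  - intros l Hl H. apply incl_down in Hl. destruct Hl as (l0 & -> & Hl).
    apply (proj2 (incl_leq _ _)). apply HC; [exact Hl|]. intros x (a & b & Ha & Hb & ->).
    apply incl_leq. apply H. exists (i a), (i b). rewrite !incl_positive.
    split; [exact Ha|]. split; [exact Hb|]. apply incl_plus; [apply Ha|apply Hb].
Qed.

Context (M : mspace (inner V0)) (HM : metric_space W M).
Notation M1 := (incl_mspace h M).

Lemma incl_dist x y : x ∈ M -> y ∈ M -> i (dist M x y) = dist M1 (i x) (i y).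
Proof.
  intros Hx Hy. unfold dist, ap2. rewrite (incl_ap (ms_fun HM)); [|now apply mem_cart_opair].
  now rewrite incl_opair.
Qed.

Lemma incl_metric_space : metric_space W1 M1.
Proof.
  constructor.
  - pose proof (incl_is_fun (ms_fun HM)) as K. now rewrite incl_cart in K.
  - intros x y Hx Hy. apply incl_down in Hx, Hy.
    destruct Hx as (x0 & -> & Hx), Hy as (y0 & -> & Hy).
    rewrite <- !incl_dist by auto. unfold is_max.
    rewrite (incl_leq (dist M x0 y0)), (incl_leq (dist M y0 x0)).
    change (zero W1) with (i (zero W)).
    assert (E : forall u v, i u = i v <-> u = v)
      by (intros u v; split; [apply incl_inj|congruence]).
    rewrite (E (zero W)), (E (zero W)), (E x0). now apply (ms_sep HM).
  - intros x y z Hx Hy Hz. apply incl_down in Hx, Hy, Hz.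
    destruct Hx as (x0 & -> & Hx), Hy as (y0 & -> & Hy), Hz as (z0 & -> & Hz).
    rewrite <- !incl_dist by auto. rewrite <- incl_plus by (apply (dist_mem HM); auto).
    apply incl_leq. now apply (ms_tri HM).
Qed.

Lemma incl_non_expanding f : non_expanding W M f -> non_expanding W1 M1 (i f).
Proof.
  intros [Hf Hd]. split; [exact (incl_is_fun Hf)|]. intros x y Hx Hy.
  apply incl_down in Hx, Hy. destruct Hx as (x0 & -> & Hx), Hy as (y0 & -> & Hy).
  rewrite <- !(incl_ap Hf) by auto.
  rewrite <- !incl_dist by (assumption || now apply (fun_ap_mem Hf)). apply incl_leq. auto.
Qed.

End Monoid.
End Absoluteness.

(** * Trees of formal balls *)

(** A node is a formal ball with centre x and radius a, together with an index n
    that counts the steps taken so far. *)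
Definition node (S : zfc_model) (n a x : S) : S := opair n (opair a x).

Lemma node_inj (S : zfc_model) (n a x n' a' x' : S) :
  node n a x = node n' a' x' -> n = n' /\ a = a' /\ x = x'.
Proof. intro H. apply opair_inj in H. destruct H as [-> H]. now apply opair_inj in H. Qed.

Definition almost_fixed (S : zfc_model) (W : monoid S) (M : mspace S) (f x a : S) : Prop :=
  exists y, opair x y ∈ f /\ dist_le W M x y a /\ dist_le W M y x a.

Definition is_node (S : zfc_model) (W : monoid S) (M : mspace S) (f o t : S) : Prop :=
  exists n a x, t = node n a x /\ n ∈ o /\ positive W a /\ x ∈ M /\ almost_fixed W M f x a.

(** The strict order of formal balls: b < a and d(x, y) + b <= a, and the same for
    d(y, x). Unlike the condition d(x, y) <= a it is transitive, so that a
    descending sequence of balls needs to be controlled at single steps only. *)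
Definition shrinks (S : zfc_model) (W : monoid S) (M : mspace S) (t u : S) : Prop :=
  exists n a x m b y, t = node n a x /\ u = node m b y /\ ~ leq W a b /\
    (exists d, opair (opair x y) d ∈ dfun M /\ sum_le W d b a) /\
    (exists d, opair (opair y x) d ∈ dfun M /\ sum_le W d b a).

(** The n-th step takes the radius below the n-th term of the coinitial
    sequence s. *)
Definition step (S : zfc_model) (W : monoid S) (M : mspace S) (s t u : S) : Prop :=
  shrinks W M t u /\ exists n a x m b y r, t = node n a x /\ u = node m b y /\
    (forall k, k ∈ m <-> k ∈ n \/ k = n) /\ opair n r ∈ s /\ leq W b r.

Ltac definability_tree :=
  unfold step, shrinks, is_node, almost_fixed, node, sum_le, dist_le, positive, leq, indom;
  definability.

Section Tree.
Context (S : zfc_model) (W : monoid S) (HW : ordered_monoid W).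
Context (M : mspace S) (HM : metric_space W M) (f : S) (Hf : non_expanding W M f).
Context (o s : S) (Ho : is_omega o) (Hs : initial_sequence W o s).

Lemma almost_fixed_iff x a : x ∈ M ->
  (almost_fixed W M f x a <-> leq W (dist M x (ap f x)) a /\ leq W (dist M (ap f x) x) a).
Proof.
  intro Hx. pose proof (map_mem Hf Hx) as Hfx. split.
  - intros (y & Hy & H & K). rewrite <- (fun_ap_eq (proj1 Hf) Hy) in H, K.
    apply (dist_le_iff HM) in H, K; auto.
  - intros [H K]. exists (ap f x). split; [exact (fun_ap (proj1 Hf) Hx)|].
    split; now apply (dist_le_iff HM).
Qed.

Lemma is_node_iff n a x : is_node W M f o (node n a x) <->
  n ∈ o /\ positive W a /\ x ∈ M /\ almost_fixed W M f x a.
Proof.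
  split.
  - intros (n' & a' & x' & E & H). apply node_inj in E. destruct E as (-> & -> & ->). exact H.
  - intro H. now exists n, a, x.
Qed.

Lemma shrinks_iff n a x m b y : a ∈ W -> b ∈ W -> x ∈ M -> y ∈ M ->
  (shrinks W M (node n a x) (node m b y) <->
   ~ leq W a b /\ leq W (plus W (dist M x y) b) a /\ leq W (plus W (dist M y x) b) a).
Proof.
  intros Ha Hb Hx Hy. split.
  - intros (n' & a' & x' & m' & b' & y' & E & E' & N & (d & Hd & K) & (d' & Hd' & K')).
    apply node_inj in E, E'. destruct E as (<- & <- & <-), E' as (<- & <- & <-).
    rewrite (dist_eq HM Hd), (dist_eq HM Hd'), <- !(sum_le_iff HW); auto;
      [rewrite <- (dist_eq HM Hd')|rewrite <- (dist_eq HM Hd)]; now apply (dist_mem HM).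
  - intros (N & K & K'). exists n, a, x, m, b, y. do 3 (split; [auto|]).
    split; [exists (dist M x y)|exists (dist M y x)];
    (split; [now apply (dist_graph HM)|apply (sum_le_iff HW); auto; now apply (dist_mem HM)]).
Qed.

Lemma shrinks_trans t u v : is_node W M f o t -> is_node W M f o u -> is_node W M f o v ->
  shrinks W M t u -> shrinks W M u v -> shrinks W M t v.
Proof.
  intros (n & a & x & -> & _ & Ha & Hx & _) (m & b & y & -> & _ & Hb & Hy & _)
    (l & c & z & -> & _ & Hc & Hz & _).
  pose proof (positive_mem Ha) as Ha'. pose proof (positive_mem Hb) as Hb'.
  pose proof (positive_mem Hc) as Hc'.
  rewrite !shrinks_iff by auto.
  intros (N & H & K) (N' & H' & K').
  pose proof (dist_mem HM Hx Hy) as Dxy. pose proof (dist_mem HM Hy Hx) as Dyx.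
  pose proof (dist_mem HM Hy Hz) as Dyz. pose proof (dist_mem HM Hz Hy) as Dzy.
  split; [|split].
  - intro L. apply N. apply (le_trans HW) with c; [exact L|].
    apply (le_trans HW) with (plus W (dist M y z) c); [|exact H'].
    now apply (le_plus_r HW).
  - apply (le_trans HW) with (plus W (dist M x y) b); [|exact H].
    apply (le_trans HW) with (plus W (dist M x y) (plus W (dist M y z) c)).
    + rewrite (om_assoc HW) by auto. apply (plus_le HW); [|now apply (le_refl HW)].
      now apply (ms_tri HM).
    + apply (plus_le HW); [now apply (le_refl HW)|exact H'].
  - apply (le_trans HW) with (plus W (dist M y x) b); [|exact K].
    apply (le_trans HW) with (plus W (dist M y x) (plus W (dist M z y) c)).
    + rewrite (om_assoc HW) by auto. apply (plus_le HW); [|now apply (le_refl HW)].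
      rewrite (om_comm HW Dyx Dzy). now apply (ms_tri HM).
    + apply (plus_le HW); [now apply (le_refl HW)|exact K'].
Qed.

Context (HC : continuous_at0 W) (Hcc : cauchy_complete W M).

(** Completeness of W provides the infima that occur in the definition of
    convergence; an infimum that is 0 has members below any positive w. *)
Lemma limit_attained p w (g : S -> S) :
  definable (fun e => exists b, indom p b /\ leq W b w /\ e 0 = g b) ->
  (forall b, indom p b -> g b ∈ W) -> positive W w ->
  is_sup W (fun v => exists a, positive W a /\
    is_inf W (fun u => exists b, indom p b /\ leq W b a /\ u = g b) v) (zero W) ->
  exists b, indom p b /\ leq W b w /\ leq W (g b) w.
Proof.
  intros Hdef Hg Hw Hsup. apply NNPP. intro N.
  destruct (@separation S (fun u => exists b, indom p b /\ leq W b w /\ u = g b) Hdef (car W))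
    as [U HU].
  assert (HU' : forall u, u ∈ U <-> exists b, indom p b /\ leq W b w /\ u = g b).
  { intro u. rewrite HU. split; [tauto|]. intros (b & Hb & H & ->). split; [auto|].
    now exists b. }
  destruct (proj1 Hcc U) as [[v (Hv & Hlow & Hgr)] _]; [intros u Hu; apply HU, Hu|].
  assert (Hv0 : leq W v (zero W)).
  { apply Hsup. exists w. split; [exact Hw|]. split; [exact Hv|]. split.
    - intros u Hu. now apply Hlow, HU'.
    - intros l Hl K. apply Hgr; [exact Hl|]. intros u Hu. now apply K, HU'. }
  apply (positive_iff HW (proj1 Hw)) in Hw as Hw'. apply Hw'.
  apply (le_trans HW) with v; [|exact Hv0]. apply Hgr; [apply Hw|].
  intros u Hu. apply HU' in Hu. destruct Hu as (b & Hb & Hbw & ->).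
  destruct (om_total HW (positive_mem Hw) (Hg b Hb)) as [L|L]; [exact L|].
  exfalso. apply N. now exists b.
Qed.

(** The two halves of convergence provide different entries of p, which are
    close to each other because p is Cauchy. *)
Lemma converges_close p x w : cauchy_seq W M p -> x ∈ M -> converges W M p x ->
  positive W w -> exists b y, opair b y ∈ p /\ y ∈ M /\ leq W b w /\
    leq W (dist M x y) w /\ leq W (dist M y x) w.
Proof.
  intros (A & HA & Hinf & Hp & Hd) Hx [H1 H2] Hw.
  destruct (halving_le HW HC Hw Hw) as (k & Hk & Hkw & Hkw').
  destruct (halving_le HW HC Hk Hk) as (m & Hm & Hmk & Hmk').
  assert (HpM : forall b, indom p b -> ap p b ∈ M).
  { intros b Hb. apply (fun_ap_mem Hp). now apply (fun_indom _ Hp). }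
  destruct (@limit_attained p m (fun b => dist M x (ap p b))) as (b & Hb & Hbm & Hxb); auto.
  { apply definable_iff with (fun e : nat -> S => exists b y, opair b y ∈ p /\ leq W b m /\
      opair (opair x y) (e 0) ∈ dfun M); [|definability_tree].
    intro e. split.
    - intros (b & Hb & Hbm & ->). exists b, (ap p b). pose proof (HpM b Hb).
      split; [apply (fun_ap Hp), (fun_indom _ Hp), Hb|]. split; [exact Hbm|].
      now apply (dist_graph HM).
    - intros (b & y & Hb & Hbm & K). exists b. split; [now exists y|].
      split; [exact Hbm|]. rewrite (fun_ap_eq Hp Hb). symmetry. exact (dist_eq HM K). }
  { intros c Hc. apply (dist_mem HM); auto. }
  destruct (@limit_attained p m (fun b => dist M (ap p b) x)) as (b' & Hb' & Hbm' & Hxb'); auto.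
  { apply definable_iff with (fun e : nat -> S => exists b y, opair b y ∈ p /\ leq W b m /\
      opair (opair y x) (e 0) ∈ dfun M); [|definability_tree].
    intro e. split.
    - intros (c & Hc & Hcm & ->). exists c, (ap p c). pose proof (HpM c Hc).
      split; [apply (fun_ap Hp), (fun_indom _ Hp), Hc|]. split; [exact Hcm|].
      now apply (dist_graph HM).
    - intros (c & y & Hc & Hcm & K). exists c. split; [now exists y|].
      split; [exact Hcm|]. rewrite (fun_ap_eq Hp Hc). symmetry. exact (dist_eq HM K). }
  { intros c Hc. apply (dist_mem HM); auto. }
  exists b, (ap p b). pose proof (HpM b Hb). pose proof (HpM b' Hb').
  apply (fun_indom _ Hp) in Hb, Hb'.
  assert (Hmw : leq W m w) by (apply (le_trans HW) with k; assumption).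
  split; [exact (fun_ap Hp Hb)|]. split; [assumption|].
  split; [now apply (le_trans HW) with m|].
  split; [now apply (le_trans HW) with m|].
  apply (le_trans HW) with (plus W k k); [|exact Hkw].
  apply (dist_tri HW HM (y:=ap p b')); auto.
  - apply (le_trans HW) with (plus W b b'); [now apply Hd|].
    apply (le_trans HW) with (plus W m m); [now apply (plus_le HW)|exact Hmk].
  - now apply (le_trans HW) with m.
Qed.

(** For an entry y close to x, the chain x, y, f y, f x has small steps: y is
    almost fixed, and f does not expand d(x, y). *)
Lemma fixed_point_of_limit p x : cauchy_seq W M p -> x ∈ M -> converges W M p x ->
  (forall b y, opair b y ∈ p -> almost_fixed W M f y b) -> ap f x = x.
Proof.
  intros Hp Hx Hconv Hfix. pose proof (map_mem Hf Hx) as Hfx.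
  assert (K : forall w, positive W w -> leq W (dist M x (ap f x)) w /\ leq W (dist M (ap f x) x) w).
  { intros w Hw.
    destruct (halving_le HW HC Hw Hw) as (k & Hk & Hkw & Hkw').
    destruct (halving_le HW HC Hk Hk) as (m & Hm & Hmk & Hmk').
    destruct (converges_close Hp Hx Hconv Hm) as (b & y & Hb & Hy & Hbm & H1 & H2).
    pose proof (map_mem Hf Hy) as Hfy.
    apply Hfix in Hb. apply almost_fixed_iff in Hb; [|exact Hy]. destruct Hb as [H3 H4].
    pose proof (proj2 Hf x y Hx Hy) as H5. pose proof (proj2 Hf y x Hy Hx) as H6.
    apply (le_trans HW) with (c:=m) in H3, H4, H5, H6; auto.
    split; apply (le_trans HW) with (plus W k k); auto.
    - apply (dist_tri HW HM (y:=y)); auto; [now apply (le_trans HW) with m|].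
      apply (le_trans HW) with (plus W m m); auto.
      now apply (dist_tri HW HM (y:=ap f y)).
    - apply (dist_tri HW HM (y:=y)); auto; [|now apply (le_trans HW) with m].
      apply (le_trans HW) with (plus W m m); auto.
      now apply (dist_tri HW HM (y:=ap f y)). }
  apply (eq_of_dist_zero HW HM); auto;
  apply (zero_of_le_positive HW HC); try (now apply (dist_mem HM)); intros w Hw; now apply K.
Qed.

(** Dependent choice gives a chain of balls that contains every index, so its
    radii are coinitial. The radii strictly decrease along the chain, so sending
    the radius of a ball to its centre is a function; the ball order makes it a
    Cauchy sequence, since d(x, y) is at most the larger of the two radii. *)
Lemma fixed_point_of_descent Y t0 :
  (forall t, t ∈ Y -> is_node W M f o t) -> t0 ∈ Y ->
  (exists z a x, t0 = node z a x /\ forall k, ~ k ∈ z) ->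
  (forall t, t ∈ Y -> exists u, u ∈ Y /\ step W M s t u) ->
  exists x, x ∈ M /\ ap f x = x.
Proof.
  intros HY H0 (z0 & a0 & x0 & E0 & Hz0) Hstep.
  destruct (@dependent_choice S Y t0 (step W M s) (shrinks W M)) as (O & HO & H0O & Hnext & Hlin);
    auto; try definability_tree.
  { intros t u H. apply H. }
  { intros t u v Ht Hu Hv. apply shrinks_trans; auto. }
  assert (HOn : forall n a x, node n a x ∈ O -> n ∈ o /\ positive W a /\ x ∈ M /\
      almost_fixed W M f x a).
  { intros n a x H. apply is_node_iff. auto. }
  assert (Hall : forall n, n ∈ o -> exists a x, node n a x ∈ O).
  { destruct (@separation S (fun n => exists a x, node n a x ∈ O)) with o as [I HI];
      [definability_tree|].
    intros n Hn. apply HI. apply (proj2 Ho); [|exact Hn]. split.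
    - intros z Hz. apply HI. split; [now apply (proj1 Ho)|].
      replace z with z0; [exists a0, x0; now rewrite <- E0|].
      apply ext. intro k. split; intro K; exfalso; [now apply (Hz0 k)|now apply (Hz k)].
    - intros k k' Hk Hk'. apply HI in Hk. destruct Hk as (Hko & a & x & Hax).
      destruct (Hnext _ Hax) as (u & Hu & _ & n' & a' & x' & m & b & y & r & E & -> & Hm & _ & _).
      apply node_inj in E. destruct E as (<- & <- & <-).
      replace k' with m; [|apply ext; intro l; now rewrite Hm, Hk'].
      apply HI. split; [apply (HOn _ _ _ Hu)|]. now exists b, y. }
  destruct (@separation S (fun z => exists n a x, z = opair a x /\ node n a x ∈ O))
    with (cart W M) as [p Hp]; [definability_tree|].
  assert (Hp' : forall a x, opair a x ∈ p <-> exists n, node n a x ∈ O).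
  { intros a x. rewrite Hp. split.
    - intros (_ & n & a' & x' & E & H). apply opair_inj in E. destruct E; subst. now exists n.
    - intros [n H]. destruct (HOn _ _ _ H) as (_ & Ha & Hx & _). split.
      + apply mem_cart_opair. split; [apply Ha|exact Hx].
      + now exists n, a, x. }
  destruct (@separation S (fun a => exists n x, node n a x ∈ O)) with (car W) as [A HA];
    [definability_tree|].
  assert (HA' : forall a, a ∈ A <-> exists x, opair a x ∈ p).
  { intro a. rewrite HA. split.
    - intros (_ & n & x & H). exists x. apply Hp'. now exists n.
    - intros (x & H). apply Hp' in H. destruct H as [n H]. split; [|now exists n, x].
      destruct (HOn _ _ _ H) as (_ & Ha & _). apply Ha. }
  assert (Hsmall : forall w, positive W w -> exists a, a ∈ A /\ leq W a w).
  { intros w Hw. destruct Hs as (_ & Hsf & _ & _ & Hcoi).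
    destruct (Hcoi w Hw) as (n & Hn & Hsn). destruct (Hall n Hn) as (a & x & Hax).
    destruct (Hnext _ Hax) as (u & Hu & _ & n' & a' & x' & m & b & y & r & E & -> & Hm & Hr & Hbr).
    apply node_inj in E. destruct E as (<- & <- & <-). exists b. split.
    - apply HA'. exists y. apply Hp'. now exists m.
    - apply (le_trans HW) with r; [exact Hbr|]. now rewrite <- (fun_ap_eq Hsf Hr). }
  (* Comparability of balls, in the form needed for functionality and for the
     Cauchy condition. *)
  assert (Hcomp : forall n a x m b y, node n a x ∈ O -> node m b y ∈ O ->
     (a = b -> x = y) /\ leq W (dist M x y) (plus W a b)).
  { intros n a x m b y Ht Hu.
    destruct (HOn _ _ _ Ht) as (_ & Ha & Hx & _), (HOn _ _ _ Hu) as (_ & Hb & Hy & _).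
    pose proof (positive_mem Ha) as Ha'. pose proof (positive_mem Hb) as Hb'.
    pose proof (dist_mem HM Hx Hy) as Dxy.
    destruct (Hlin _ _ Ht Hu) as [E|[K|K]].
    - apply node_inj in E. destruct E as (_ & <- & <-). split; [auto|].
      rewrite (dist_self HM Hx). apply (zero_le HW), (plus_mem HW); assumption.
    - apply shrinks_iff in K; auto. destruct K as (N & K & _). split.
      + intros <-. exfalso. apply N. now apply (le_refl HW).
      + apply (le_trans HW) with a; [|now apply (le_plus_l HW)].
        apply (le_trans HW) with (plus W (dist M x y) b); [now apply (le_plus_l HW)|exact K].
    - apply shrinks_iff in K; auto. destruct K as (N & _ & K). split.
      + intros ->. exfalso. apply N. now apply (le_refl HW).
      + apply (le_trans HW) with b; [|now apply (le_plus_r HW)].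
        apply (le_trans HW) with (plus W (dist M x y) a); [now apply (le_plus_l HW)|exact K]. }
  assert (Hpf : is_fun p A M).
  { split.
    - intros t Ht. pose proof Ht as Ht'. apply Hp in Ht'. destruct Ht' as (_ & n & a & x & -> & H).
      apply mem_cart_opair. split; [apply HA'; now exists x|]. apply (HOn _ _ _ H).
    - intros a Ha. apply HA' in Ha. destruct Ha as [x Hx]. exists x. split; [exact Hx|].
      intros y Hy. apply Hp' in Hx, Hy. destruct Hx as [n Hx], Hy as [m Hy].
      now apply (Hcomp _ _ _ _ _ _ Hx Hy). }
  assert (Hcauchy : cauchy_seq W M p).
  { exists A. split; [|split; [|split]].
    - intros a Ha. apply HA in Ha. destruct Ha as (_ & n & x & H). apply (HOn _ _ _ H).
    - assert (HAW : forall a, a ∈ A -> a ∈ W) by (intros a Ha; now apply HA in Ha).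
      split; [apply (zero_mem HW)|]. split.
      + intros u (a & b & Ha & Hb & ->). apply (zero_le HW), (plus_mem HW); auto.
      + intros l Hl K. rewrite (lower_bound_sums HW HC (l:=l)).
        * apply (le_refl HW), (zero_mem HW).
        * exact Hl.
        * intros b c Hb Hc. destruct (Hsmall b Hb) as (b' & Hb' & Lb).
          destruct (Hsmall c Hc) as (c' & Hc' & Lc).
          apply (le_trans HW) with (plus W b' c'); [|now apply (plus_le HW)].
          apply K. now exists b', c'.
    - exact Hpf.
    - intros a b Ha Hb. pose proof (fun_ap Hpf Ha) as Ka. pose proof (fun_ap Hpf Hb) as Kb.
      apply Hp' in Ka, Kb. destruct Ka as [n Ka], Kb as [m Kb].
      apply (Hcomp _ _ _ _ _ _ Ka Kb). }
  destruct (proj2 Hcc p Hcauchy) as (x & Hx & Hconv). exists x. split; [exact Hx|].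
  apply fixed_point_of_limit with p; auto.
  intros b y Hb. apply Hp' in Hb. destruct Hb as [n Hb]. apply (HOn _ _ _ Hb).
Qed.

End Tree.

(** * Descending into an almost fixed Cauchy sequence of the larger model *)

Section Descent.
Context (B : zfc_model) (V0 V1 : transitive_model B).
Context (h : forall x : B, V0 x -> V1 x).
Notation i := (incl h).

Context (W : monoid (inner V0)) (HW : ordered_monoid W) (HC : continuous_at0 W).
Context (M : mspace (inner V0)) (HM : metric_space W M).
Context (f : inner V0) (Hf : non_expanding W M f).
Context (o s : inner V0) (Ho : is_omega o) (Hs : initial_sequence W o s).
Notation W1 := (incl_monoid h W).
Notation M1 := (incl_mspace h M).

(** N x a stands for: x is within a of a given fixed point of the larger model.
    As a predicate on V0 it need not be definable in V0. *)
Context (N : inner V0 -> inner V0 -> Prop).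
Context (N_exists : forall a, positive W a -> exists x, x ∈ M /\ N x a).
Context (N_close : forall x y a b, x ∈ M -> y ∈ M -> a ∈ W -> b ∈ W -> N x a -> N y b ->
  leq W (dist M x y) (plus W a b)).
Context (N_fixed : forall y k k', y ∈ M -> k ∈ W -> k' ∈ W -> ~ leq W k' k -> N y k ->
  leq W (dist M y (ap f y)) (plus W k k') /\ leq W (dist M (ap f y) y) (plus W k' k)).

(** The ball contains the fixed point with a positive margin k. The margin is the
    room in which a smaller ball around a better approximation fits. *)
Definition captures (a x : inner V0) : Prop :=
  exists g k, g ∈ W /\ positive W k /\ leq W (plus W g k) a /\ N x g.

(** With g < k and k + k <= r, a centre y within g of the fixed point is moved by
    at most g + k <= r, and k is also the margin. *)
Lemma capturing_node n r : n ∈ o -> positive W r -> exists y g, y ∈ M /\ g ∈ W /\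
  leq W g r /\ N y g /\ is_node W M f o (node n r y) /\ captures r y.
Proof.
  intros Hn Hr. destruct (halving HW HC Hr) as (k & Hk & Hkr).
  destruct (smaller HW HC Hk) as (g & Hg & Hgk & Hgk').
  destruct (N_exists Hg) as (y & Hy & HN).
  pose proof (positive_mem Hk) as Hk0. pose proof (positive_mem Hg) as Hg0.
  pose proof (le_refl HW Hk0) as Hkk.
  assert (H1 : leq W (plus W g k) r).
  { apply (le_trans HW) with (plus W k k); [|exact Hkr]. now apply (plus_le HW). }
  exists y, g. do 2 (split; [assumption|]). split; [|split; [exact HN|split]].
  - apply (le_trans HW) with (plus W g k); [|exact H1]. now apply (le_plus_l HW).
  - apply is_node_iff. do 3 (split; [assumption|]). apply (almost_fixed_iff HM Hf _ Hy).
    destruct (N_fixed Hy Hg0 Hk0 Hgk' HN) as [H2 H3]. rewrite (om_comm HW Hk0 Hg0) in H3.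
    split; now apply (le_trans HW) with (plus W g k).
  - now exists g, k.
Qed.

(** With g, k the bounds of the given ball, the new ball has its centre y within
    g' <= r of the fixed point, where r + r <= k. So d(x, y) + r is at most
    g + g' + r <= g + k <= a. *)
Lemma capturing_step n a x : is_node W M f o (node n a x) -> captures a x ->
  exists m r y, is_node W M f o (node m r y) /\ captures r y /\
    step W M s (node n a x) (node m r y).
Proof.
  intros Hnode (g & k & Hg & Hk & Hgk & HN). apply is_node_iff in Hnode.
  destruct Hnode as (Hn & Ha & Hx & _). destruct Hs as (_ & Hsf & Hspos & _).
  destruct (halving_le HW HC Hk (Hspos n Hn)) as (r1 & Hr1 & Hr1k & Hr1s).
  destruct (smaller HW HC Ha) as (r2 & Hr2 & Hr2a & Hr2a').
  destruct (positive_min HW Hr1 Hr2) as (r & Hr & Hrr1 & Hrr2).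
  destruct (insert_ex n n) as [m Hm].
  assert (Hmo : m ∈ o) by (eapply (proj1 Ho); eauto).
  destruct (capturing_node Hmo Hr) as (y & g' & Hy & Hg' & Hg'r & HN' & Hnode & Hcap).
  exists m, r, y. split; [exact Hnode|]. split; [exact Hcap|].
  pose proof (positive_mem Ha) as Ha0. pose proof (positive_mem Hr) as Hr0.
  pose proof (positive_mem Hk) as Hk0.
  assert (Hg'k : leq W (plus W g' r) k).
  { apply (le_trans HW) with (plus W r1 r1); [|exact Hr1k].
    apply (plus_le HW); [now apply (le_trans HW) with r|exact Hrr1]. }
  assert (Hsum : leq W (plus W (plus W g g') r) a).
  { apply (le_trans HW) with (plus W g k); [|exact Hgk].
    rewrite <- (om_assoc HW) by assumption. apply (plus_le HW); [|exact Hg'k].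
    now apply (le_refl HW). }
  split.
  - apply (shrinks_iff HW HM); auto. split; [|split].
    + intro L. apply Hr2a'. now apply (le_trans HW) with r.
    + apply (le_trans HW) with (plus W (plus W g g') r); [|exact Hsum].
      apply (plus_le HW); [now apply N_close|now apply (le_refl HW)].
    + apply (le_trans HW) with (plus W (plus W g g') r); [|exact Hsum].
      apply (plus_le HW); [|now apply (le_refl HW)].
      rewrite (om_comm HW Hg Hg'). now apply N_close.
  - exists n, a, x, m, r, y, (ap s n). do 3 (split; [auto|]).
    split; [exact (fun_ap Hsf Hn)|]. now apply (le_trans HW) with r1.
Qed.

(** In the larger model, the values that g takes on capturing nodes would form a
    set contradicting foundation: each capturing node has a capturing successor,
    and g has an element of the value at the node as value there. *)
Lemma capturing_unranked X g n a x : (forall t, t ∈ X <-> is_node W M f o t) ->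
  collapse X (step W M s) g ->
  (exists b, forall v : inner V1, v ∈ b <-> exists n a x, is_node W M f o (node n a x) /\
     captures a x /\ opair (i (node n a x)) v ∈ i g) ->
  is_node W M f o (node n a x) -> captures a x -> ~ indom g (node n a x).
Proof.
  intros HX (_ & _ & Hdesc & _) [b Hb] Hnode Hcap [v Hv].
  destruct (@zf_foundation _ _ (zfc_axioms (inner V1)) b) as (m & Hm & Hmin).
  { exists (i v). apply Hb. exists n, a, x. split; [exact Hnode|]. split; [exact Hcap|].
    now apply incl_opair_mem. }
  apply Hb in Hm. destruct Hm as (n1 & a1 & x1 & Hnode1 & Hcap1 & Hm).
  assert (Hm' : exists m0, m = i m0).
  { assert (K := Hm). apply incl_down in K. destruct K as (z & Ez & Hz).
    destruct (incl_down (h:=h) (z:=upair (i (node n1 a1 x1)) m) (x:=z)) as (z1 & E1 & Hz1).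
    { rewrite <- Ez. apply mem_upair. auto. }
    destruct (incl_down (h:=h) (z:=m) (x:=z1)) as (m0 & E2 & _).
    { rewrite <- E1. apply mem_upair. auto. }
    now exists m0. }
  destruct Hm' as [m0 ->]. apply incl_opair_mem in Hm.
  destruct (capturing_step Hnode1 Hcap1) as (n2 & a2 & x2 & Hnode2 & Hcap2 & Hst).
  apply HX in Hnode2 as HX2.
  destruct (Hdesc _ _ _ Hm HX2 Hst) as (w & Hw & Hwm).
  apply Hmin. exists (i w). split; [exact Hwm|]. apply Hb. exists n2, a2, x2.
  split; [exact Hnode2|]. split; [exact Hcap2|]. now apply incl_opair_mem.
Qed.

End Descent.

Theorem theorem5p3 (B : zfc_model) (V0 V1 : transitive_model B)
  (h : forall x : B, V0 x -> V1 x)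
  (G0 : system (inner V0)) (G1 : system (inner V1))
  (hG0 : generalized_dynamical_system G0)
  (hG1 : relativization h G0 G1)
  (hcont : continuous (scale G0))
  (o : inner V0) (ho : is_omega o) (hcoinit : is_coinit (scale G0) o) :
  has_fixed_point G0 <-> has_fixed_point G1.
Proof.
  destruct hG0 as (HD & HM & Hcc & Hf). destruct hcont as [_ HC].
  apply distance_monoid_ordered in HD as HW.
  destruct hG1 as (HB & M' & HR & Hyes & _). cbn [scale space self_map incl_system] in *.
  pose proof (incl_ordered_monoid h HW) as HW1.
  pose proof (incl_continuous_at0 h HW HC) as HC1.
  pose proof (incl_metric_space h HW HM) as HM1.
  pose proof (incl_non_expanding h HM Hf) as Hf1.
  destruct (Hyes HC1) as (HQ & Hfc & Hext).
  split.
  - intros (x & Hx & E).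
    assert (E1 : ap (incl h (self_map G0)) (incl h x) = incl h x).
    { rewrite <- (incl_ap h (proj1 Hf) Hx). now rewrite E. }
    exact (fixed_point_to_completion HW1 HM1 HC1 HB HR HQ Hext (x:=incl h x) Hx E1).
  - intros (c & Hc & E).
    destruct (cq_class HQ Hc) as (p & Hp & Hpc).
    destruct hcoinit as [[s Hs] _].
    set (W := scale G0) in *. set (M := space G0) in *. set (f := self_map G0) in *.
    pose (N := fun x g => near (incl_monoid h W) (incl_mspace h M) (scale G1) p (incl h x) (incl h g)).
    assert (N_exists : forall a, positive W a -> exists x, x ∈ M /\ N x a).
    { intros a Ha. apply (incl_positive h) in Ha.
      destruct (near_exists HW1 HM1 HC1 HB HR Hp Ha) as (x & Hx & Hn).
      apply incl_down in Hx. destruct Hx as (x0 & -> & Hx). now exists x0. }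
    assert (N_close : forall x y a b, x ∈ M -> y ∈ M -> a ∈ W -> b ∈ W -> N x a -> N y b ->
      leq W (dist M x y) (plus W a b)).
    { intros x y a b Hx Hy Ha Hb Hxa Hyb. apply (incl_leq h).
      rewrite (incl_dist h HM Hx Hy), (incl_plus h HW Ha Hb).
      exact (near_close HW1 HM1 HB HR (x:=incl h x) (y:=incl h y) Hp Hx Hy Hxa Hyb). }
    assert (N_fixed : forall y k k', y ∈ M -> k ∈ W -> k' ∈ W -> ~ leq W k' k -> N y k ->
      leq W (dist M y (ap f y)) (plus W k k') /\ leq W (dist M (ap f y) y) (plus W k' k)).
    { intros y k k' Hy Hk Hk' Hkk' Hn. pose proof (map_mem Hf Hy) as Hfy.
      rewrite <- !(incl_leq h), (incl_dist h HM Hy Hfy), (incl_dist h HM Hfy Hy),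
        (incl_plus h HW Hk Hk'), (incl_plus h HW Hk' Hk), (incl_ap h (proj1 Hf) Hy).
      apply (near_almost_fixed HW1 HM1 HC1 HB HR HQ Hf1 Hfc Hext Hp Hpc Hc E); auto.
      now rewrite incl_leq. }
    (* If the root were in the well-founded part, its rank function would still
       decrease along the capturing balls of V1. Hence V0 has a descending
       sequence of balls below the root. *)
    destruct (@separation _ (is_node W M f o)) with (cart o (cart W M)) as [X HX];
      [definability_tree|].
    assert (HX' : forall t, t ∈ X <-> is_node W M f o t).
    { intro t. rewrite HX. split; [tauto|]. intro Ht. split; [|exact Ht].
      destruct Ht as (n & a & x & -> & Hn & [Ha _] & Hx & _).
      apply mem_cart_opair. split; [exact Hn|]. now apply mem_cart_opair. }
    destruct (@collapse_well_founded_part _ X (step W M s)) as (g & Hg & Hunr);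
      [definability_tree|].
    pose proof Hs as (_ & _ & Hspos & _).
    (* The root has index z = 0. *)
    destruct (zf_infinity (zfc_axioms (inner V0))) as (I & (z & Hz & _) & _).
    assert (Hzo : z ∈ o) by now apply (proj1 ho).
    destruct (capturing_node HW HC HM Hf N_exists N_fixed Hzo (Hspos z Hzo))
      as (x0 & _ & _ & _ & _ & _ & Hnode & Hcap).
    assert (Hroot : ~ indom g (node z (ap s z) x0)).
    { apply (capturing_unranked (h:=h) HW HC HM Hf ho Hs N_exists N_close N_fixed HX' Hg); auto.
      destruct (field_ex (incl h g)) as [u Hu].
      destruct (@separation _ (fun v => exists t n a x l k, t ∈ incl h X /\ t = node n a x /\
        l ∈ incl_monoid h W /\ positive (incl_monoid h W) k /\ sum_le (incl_monoid h W) l k a /\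
        near (incl_monoid h W) (incl_mspace h M) (scale G1) p x l /\ opair t v ∈ incl h g))
        with u as [b Hb]; [unfold near; definability_tree|].
      exists b. intro v. rewrite Hb. unfold node in *. split.
      - intros (_ & t & n & a & x & l & k & Ht & Et & Hl & Hk & Hs' & Hn & Hv).
        apply incl_down in Ht. destruct Ht as (t0 & -> & Ht). apply HX' in Ht.
        destruct Ht as (n0 & a0 & y0 & -> & Ht). unfold node in *.
        rewrite !incl_opair in Et. apply node_inj in Et. destruct Et as (<- & <- & <-).
        apply incl_down in Hl. destruct Hl as (l0 & -> & Hl).
        pose proof (positive_mem Hk) as Hk0. apply incl_down in Hk0.
        destruct Hk0 as (k0 & -> & Hk0).
        exists n0, a0, y0. split; [now exists n0, a0, y0|]. split; [|exact Hv].
        exists l0, k0. split; [exact Hl|]. split; [now apply (incl_positive h)|].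
        split; [|exact Hn]. apply (sum_le_iff HW1) in Hs'; auto.
        rewrite <- (incl_plus h HW Hl Hk0) in Hs'. now apply incl_leq in Hs'.
      - intros (n & a & x & Ht & (l & k & Hl & Hk & Hlk & Hn) & Hv).
        split; [apply (Hu _ _ Hv)|].
        exists (incl h (opair n (opair a x))), (incl h n), (incl h a), (incl h x), (incl h l), (incl h k).
        split; [now apply HX'|]. split; [now rewrite !incl_opair|]. split; [exact Hl|].
        split; [now apply incl_positive|]. split; [|split; [exact Hn|exact Hv]].
        pose proof (positive_mem Hk) as Hk0. apply (sum_le_iff HW1); auto.
        rewrite <- (incl_plus h HW Hl Hk0). now apply incl_leq. }
    destruct (@separation _ (fun t => ~ indom g t)) with X as [Y HY]; [definability_tree|].
    apply (@fixed_point_of_descent _ W HW M HM f Hf o s ho Hs HC Hcc Y (node z (ap s z) x0)).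
    + intros t Ht. now apply HX', HY.
    + apply HY. split; [now apply HX'|exact Hroot].
    + now exists z, (ap s z), x0.
    + intros t Ht. apply HY in Ht. destruct Ht as [Ht Nt].
      destruct (Hunr t Ht Nt) as (t' & Ht' & Hst & Nt'). exists t'. split; [|exact Hst].
      now apply HY.
Qed.
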